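(* Let $d,m,m_{\mathrm{train}},m_{\mathrm{test}}\in\mathbb{N}$ and $\tilde\varepsilon>0$. Let $\rho_0$ be an (unknown) state on $\mathbb{C}^d$, let $P$ be an (unknown) probability distribution on a measurable space $\mathsf{Z}$ each of whose points $z$ has an associated effect operator $E(z)$ on $\mathbb{C}^d$, and let $\mathsf{W}$ be a measurable hypothesis space each of whose points $w$ has an associated state $\rho_0(w)$ on $\mathbb{C}^d$. Let $\mathcal{A}$ be the covering-net empirical-risk-minimization learner described in the context (with parameters $m$, $m_{\mathrm{train}}$, $m_{\mathrm{test}}$, $\tilde\varepsilon$), acting on the data state $\rho$ described there. Then its expected excess prediction error satisfies $$\operatorname{excess}_\rho(\mathcal{A})\le\tilde\varepsilon+\tilde{\mathcal{O}}\left(\sqrt{\frac{\log(d)}{m\,\tilde\varepsilon^2}}+\frac{1}{\sqrt{m_{\mathrm{train}}}}+\frac{1}{\sqrt{m_{\mathrm{test}}}}\right).$$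
   Context: An effect operator on $\mathbb{C}^d$ is a self-adjoint $E$ with $0\le E\le\mathbb{1}$; a state is a positive semidefinite operator of trace one. **Data.** $S=(Z_1,\dots,Z_{2m})\sim P^{2m}$, and the classical-quantum data state is $\rho=\mathbb{E}_{S\sim P^{2m}}\left[\left(\bigotimes_{i=1}^{2m}|Z_i\rangle\langle Z_i|\right)\otimes(\rho_0^{\otimes m_{\mathrm{test}}})^{\otimes m}\otimes(\rho_0^{\otimes m_{\mathrm{train}}})^{\otimes m}\right]$; i.e. besides $S$, the learner has $m_{\mathrm{train}}$ independent copies of $\rho_0$ for each index $i\in\{m+1,\dots,2m\}$, and there are likewise $m_{\mathrm{test}}$ copies per index reserved for testing. **Learner $\mathcal{A}$.** Here $\tilde\varepsilon>0$ is an auxiliary accuracy parameter. Step 1: from $z_1,\dots,z_m$, the learner chooses an $\tilde\varepsilon$-covering net $\mathsf{W}_1\subset\mathsf{W}$ of $\mathsf{W}$ with respect to the empirical seminorm $\|w\|_{2,\{z_j\}_{j=1}^m}=\sqrt{\frac1m\sum_{j=1}^m|\operatorname{Tr}[E(z_j)\rho_0(w)]|^2}$, i.e. for every $w\in\mathsf{W}$ there is $w_1\in\mathsf{W}_1$ with $\sqrt{\frac1m\sum_{j=1}^m|\operatorname{Tr}[E(z_j)(\rho_0(w)-\rho_0(w_1))]|^2}\le\tilde\varepsilon$. The net is taken with cardinality $|\mathsf{W}_1|\le(2/\tilde\varepsilon)^{C_0\log(d)/\tilde\varepsilon^2}$ for some constant $C_0>0$. Step 2: for each $m+1\le i\le 2m$,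 the learner measures the two-outcome POVM $\{E(z_i),\mathbb{1}-E(z_i)\}$ separately on $m_{\mathrm{train}}$ copies of $\rho_0$, obtaining outcomes $b^{(i)}_\ell\in\{0,1\}$, $1\le\ell\le m_{\mathrm{train}}$ (conditionally on $S$ independent, equal to $1$ with probability $\operatorname{Tr}[E(z_i)\rho_0]$), and sets $\tilde b^{(i)}=\frac{1}{m_{\mathrm{train}}}\sum_{\ell=1}^{m_{\mathrm{train}}}b^{(i)}_\ell$. It outputs $$\hat w\in\operatorname{argmin}_{w\in\mathsf{W}_1}\frac1m\sum_{i=m+1}^{2m}\left|\operatorname{Tr}[E(z_i)\rho_0(w)]-\tilde b^{(i)}\right|,$$ with ties broken arbitrarily but deterministically. Let $\hat W$ denote the random output. **Excess prediction error.** With $\bar Z\sim P$ independent of $\hat W$, $$\operatorname{excess}_\rho(\mathcal{A})=\mathbb{E}_{\hat W}\mathbb{E}_{\bar Z}\left[\left|\operatorname{Tr}[E(\bar Z)\rho_0]-\operatorname{Tr}[E(\bar Z)\rho_0(\hat W)]\right|\right]-\inf_{w\in\mathsf{W}}\mathbb{E}_{\bar Z}\left[\left|\operatorname{Tr}[E(\bar Z)\rho_0]-\operatorname{Tr}[E(\bar Z)\rho_0(w)]\right|\right].$$ **Asymptotic notation.** $\tilde{\mathcal{O}}(\cdot)$ hides absolute multiplicative constants and non-leading logarithmic factors. *)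

(* Defs.v *)
From HB Require Import structures.
From mathcomp Require Import all_boot all_order all_algebra finmap.
From mathcomp Require Import spectral complex.
From mathcomp Require Import all_classical all_reals all_analysis.
Set Implicit Arguments.
Unset Strict Implicit.
Unset Printing Implicit Defensive.
Import Order.TTheory GRing.Theory Num.Theory.
Import numFieldNormedType.Exports.
Local Open Scope classical_set_scope.
Local Open Scope ring_scope.
Local Open Scope complex_scope.

Section Operators.
Context (R : realType) (d : nat).
Implicit Types A E rho : 'M[R[i]]_d.

Definition psdmx A : Prop :=
  A \is hermsymmx /\
  forall v : 'cV[R[i]]_d, 0 <= (map_mx Num.conj v^T *m A *m v) ord0 ord0.

Definition effect E : Prop := psdmx E /\ psdmx (1%:M - E).

Definition state rho : Prop := psdmx rho /\ \tr rho = 1.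

(* Tr[E rho] is real when E and rho are Hermitian; taking the real part only
   changes its type from R[i] to R. *)
Definition prob_outcome E rho : R := complex.Re (\tr (E *m rho)).

(* The two-outcome POVM {E, 1 - E}, outcome true having effect E. *)
Definition povm2 E (b : bool) : 'M[R[i]]_d := if b then E else 1%:M - E.

(* Borel measurability of a matrix-valued map, entry by entry. *)
Definition measurable_mx (dT : measure_display) (T : measurableType dT)
    (F : T -> 'M[R[i]]_d) : Prop :=
  forall i j, measurable_fun setT (fun t => complex.Re (F t i j)) /\
              measurable_fun setT (fun t => complex.Im (F t i j)).

(* The tensor product of the A i, on (C^d)^{(x) I}: the computational basis of
   that space is indexed by the functions I -> 'I_d. *)
Definition tens (I : finType) (A : I -> 'M[R[i]]_d) :
    'M[R[i]]_#|{ffun I -> 'I_d}| :=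
  \matrix_(a, b)
    \prod_(i : I) A i ((enum_val a : {ffun I -> 'I_d}) i)
                      ((enum_val b : {ffun I -> 'I_d}) i).

End Operators.

Section ProductLaw.
Context (R : realType) (dZ : measure_display) (Z : measurableType dZ).

Definition cons_pair n (x : Z * n.-tuple Z) : n.+1.-tuple Z :=
  [tuple of x.1 :: x.2].

Lemma measurable_cons_pair n : measurable_fun setT (@cons_pair n).
Proof. exact: measurable_cons. Qed.

HB.instance Definition _ n :=
  isMeasurableFun.Build _ _ _ _ (@cons_pair n) (@measurable_cons_pair n).

(* The law P^n of n independent draws from P. *)
Fixpoint iid_law (P : probability Z R) (n : nat) : probability (n.-tuple Z) R :=
  match n with
  | 0 => dirac [tuple]
  | n'.+1 => distribution (P \x iid_law P n')%E (@cons_pair n')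
  end.

Lemma iid_law_rect (P : probability Z R) n (A : 'I_n -> set Z) :
  (forall i, measurable (A i)) ->
  iid_law P n [set s | forall i, A i (tnth s i)] = (\prod_(i < n) P (A i))%E.
Proof.
elim: n A => [|n IH] A mA.
  rewrite big_ord0 /= diracE mem_set//= => -[]//.
rewrite big_ord_recl /= /distribution /pushforward /=.
rewrite -IH // -product_measure1E //; last first.
  rewrite [X in measurable X](_ : _ = \bigcap_(i in [set: 'I_n])
    ((fun s : n.-tuple Z => tnth s i) @^-1` A (lift ord0 i))); last first.
    by apply/seteqP; split => s /= H i; [move=> _|]; exact: H.
  apply: fin_bigcap_measurable => // i _.
  by rewrite -[X in measurable X]setTI; apply: measurable_tnth.
congr (_ _); apply/seteqP; split => -[z s] /=.
  move=> H; split; first exact: (H ord0).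
  by move=> i; have := H (lift ord0 i); rewrite tnthS.
move=> [H0 H] i; case: (unliftP ord0 i) => [j ->|->]; last exact: H0.
by rewrite tnthS; exact: H.
Qed.

End ProductLaw.

(* The classical-quantum state
     E_(x ~ cq_law) [ |x><x| (x) cq_cond x ],
   recorded by the law of its classical register and the conditional states of
   its quantum register. *)
Record cq_state (R : realType) (dX : measure_display) (X : measurableType dX)
    (n : nat) := CQState {
  cq_law : probability X R;
  cq_cond : X -> 'M[R[i]]_n
}.

(* One copy of C^d for each test copy and each training copy attached to one of
   the m indices m+1, ..., 2m. *)
Definition copies (m m_test m_train : nat) : finType :=
  ('I_m * 'I_m_test + 'I_m * 'I_m_train)%type.

Section Learning.
Context (R : realType) (d : nat) (dZ : measure_display) (Z : measurableType dZ).
Variable E : Z -> 'M[R[i]]_d.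

Definition data_state (P : probability Z R) (rho0 : 'M[R[i]]_d)
    (m m_test m_train : nat) :
    cq_state R ((m + m).-tuple Z)
      #|{ffun copies m m_test m_train -> 'I_d}| :=
  CQState (iid_law P (m + m))
    (fun _ => tens (fun _ : copies m m_test m_train => rho0)).

Definition first_half m (s : (m + m).-tuple Z) : m.-tuple Z :=
  [tuple tnth s (lshift m j) | j < m].

Definition second_half m (s : (m + m).-tuple Z) : m.-tuple Z :=
  [tuple tnth s (rshift m j) | j < m].

Definition outcomes (m m_train : nat) := {ffun 'I_m * 'I_m_train -> bool}.

(* The joint effect of the outcome array b when, conditionally on s, the POVM
   {E(z_(m+i)), 1 - E(z_(m+i))} is measured on every training copy of index
   m+i; the test copies are left untouched. *)
Definition measurement m m_test m_train (s : (m + m).-tuple Z)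
    (b : outcomes m m_train) : 'M[R[i]]_#|{ffun copies m m_test m_train -> 'I_d}| :=
  tens (fun c : copies m m_test m_train =>
    match c with
    | inl _ => 1%:M
    | inr il => povm2 (E (tnth (second_half s) il.1)) (b il)
    end).

Section Hypotheses.
Context (dW : measure_display) (W : measurableType dW).
Variable hyp : W -> 'M[R[i]]_d.

Definition emp_dist m (z : m.-tuple Z) (w w1 : W) : R :=
  Num.sqrt (m%:R^-1 * \sum_(j < m)
    `|complex.Re (\tr (E (tnth z j) *m (hyp w - hyp w1)))| ^+ 2).

Definition emp_freq m m_train (b : outcomes m m_train) (i : 'I_m) : R :=
  m_train%:R^-1 * \sum_(l < m_train) (b (i, l))%:R.

Definition emp_loss m m_train (z : m.-tuple Z) (b : outcomes m m_train)
    (w : W) : R :=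
  m%:R^-1 * \sum_(i < m)
    `|prob_outcome (E (tnth z i)) (hyp w) - emp_freq b i|.

(* The learner knows E and hyp but neither P nor rho0.  Its output is a
   deterministic function of the sample and the measurement outcomes (this
   fixes the tie-breaking), measurable so that it is a W-valued random
   variable. *)
Record learner (C0 eps : R) (m m_train : nat) := Learner {
  net : m.-tuple Z -> {fset W};
  net_covering : forall z w, exists2 w1, w1 \in net z & emp_dist z w w1 <= eps;
  net_card : forall z,
    (#|` net z|)%:R <= (2 / eps) `^ (C0 * ln d%:R / eps ^+ 2);
  output : (m + m).-tuple Z -> outcomes m m_train -> W;
  output_net : forall s b, output s b \in net (first_half s);
  output_argmin : forall s b w, w \in net (first_half s) ->
    emp_loss (second_half s) b (output s b) <= emp_loss (second_half s) b w;
  output_measurable : forall b, measurable_fun setT (output ^~ b)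
}.

Definition pred_error (P : probability Z R) (rho0 : 'M[R[i]]_d) (w : W) : R :=
  \int[P]_z `|prob_outcome (E z) rho0 - prob_outcome (E z) (hyp w)|.

(* E_(W^) averages over the classical register of rho and, conditionally on it,
   over the outcomes of the learner's measurement (Born rule). *)
Definition excess (P : probability Z R) (rho0 : 'M[R[i]]_d)
    (C0 eps : R) (m m_test m_train : nat)
    (rho : cq_state R ((m + m).-tuple Z)
      #|{ffun copies m m_test m_train -> 'I_d}|)
    (A : learner C0 eps m m_train) : R :=
  \int[cq_law rho]_s (\sum_(b : outcomes m m_train)
      prob_outcome (measurement m_test s b) (cq_cond rho s) *
      pred_error P rho0 (output A s b))
  - inf [set pred_error P rho0 w | w in [set: W]].

End Hypotheses.
End Learning.

(* Main.v *)
(* Uniform convergence over all states at once controls both halves of the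
   sample.  For fixed effects A_j, the supremum over states of
   sum_j sigma_j Tr[A_j rho] is the largest eigenvalue of the Rademacher series
   X = sum_j sigma_j A_j, so a noncommutative Khintchine bound on the moments
   E Tr X^(2p) with p ~ log d gives a Rademacher complexity of order
   sqrt(log d / m).  Contraction and symmetrization, carried out one coordinate
   at a time, transfer this to the absolute losses |Tr[E rho(w)] - target|.
   The second half of the sample compares the empirical minimizer to the net
   point closest to a near-optimal hypothesis, and the first half turns the
   empirical covering radius into a population one at the same rate, which keeps
   the coefficient of the covering radius equal to 1.  Suprema over W need not
   be measurable, so they are replaced by maxima over a finite net of the image
   of W in the state space, whose mesh is sent to 0. *)

Require Import Defs.
From mathcomp Require Import all_boot all_order all_algebra finmap.
From mathcomp Require Import spectral complex.
From mathcomp Require Import all_classical all_reals all_analysis.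
From mathcomp Require Import measurable_realfun ring lra.
Set Implicit Arguments.
Unset Strict Implicit.
Unset Printing Implicit Defensive.
Import Order.TTheory GRing.Theory Num.Theory.
Import numFieldNormedType.Exports.
Local Open Scope classical_set_scope.
Local Open Scope ring_scope.
Local Open Scope complex_scope.

(** * Hermitian matrices *)

Section HermitianMatrices.
Context (R : realType) (d : nat).
Implicit Types (A B X Y rho U V : 'M[R[i]]_d).

Local Notation "A ^h" := (map_mx Num.conj A^T) (at level 8, format "A ^h").
Local Notation retr A := (complex.Re (\tr A)).

Lemma retrD A B : retr (A + B) = retr A + retr B.
Proof. by rewrite mxtraceD; case: (\tr A) (\tr B) => ? ? [? ?]. Qed.

Lemma retrN A : retr (- A) = - retr A.
Proof. by rewrite raddfN /=; case: (\tr A). Qed.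

Lemma retr_sum (I : Type) (r : seq I) (Q : pred I) (F : I -> 'M[R[i]]_d) :
  retr (\sum_(i <- r | Q i) F i) = \sum_(i <- r | Q i) retr (F i).
Proof.
elim/big_rec2: _ => [|i y1 y2 _ <-]; first by rewrite mxtrace0.
by rewrite retrD.
Qed.

Lemma retrZ (a : R) A : retr (a%:C *: A) = a * retr A.
Proof.
by rewrite mxtraceZ; case: (\tr A) => u v; rewrite /= mul0r subr0.
Qed.

Lemma hermsymmxE A : A \is hermsymmx -> A^h = A.
Proof. by move/is_hermitianmxP; rewrite expr0 scale1r => <-. Qed.

Lemma psdmx_herm A : psdmx A -> A^h = A.
Proof. by case=> /hermsymmxE. Qed.

Lemma hermP A : A^h = A -> A \is hermsymmx.
Proof. by move=> hA; apply/is_hermitianmxP; rewrite expr0 scale1r hA. Qed.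

Lemma mulmx_herm m n p (A : 'M[R[i]]_(m, n)) (B : 'M[R[i]]_(n, p)) :
  (A *m B)^h = B^h *m A^h.
Proof. by rewrite trmx_mul map_mxM. Qed.

Lemma hermK m n (A : 'M[R[i]]_(m, n)) : (A^h)^h = A.
Proof. exact: trmxCK. Qed.

(* Working with real eigenvalues lets all later estimates live in [R]. *)
Lemma hermitian_spectral A : A \is hermsymmx ->
  exists (U : 'M[R[i]]_d) (x : 'I_d -> R),
    [/\ U *m U^h = 1%:M, U^h *m U = 1%:M
      & forall k, A ^+ k = U^h *m diag_mx (\row_j (x j ^+ k)%:C) *m U].
Proof.
move=> Ah; pose U := spectralmx A.
have Uu : U \is unitarymx by exact: spectral_unitarymx.
have UU : U *m U^h = 1%:M by apply/unitarymxP.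
have UU' : U^h *m U = 1%:M by exact: mulmx1C.
exists U, (fun j => complex.Re (spectral_diag A 0 j)); split=> //.
have /orthomx_spectralP AE := hermitian_normalmx Ah.
have xE j : (complex.Re (spectral_diag A 0 j))%:C = spectral_diag A 0 j.
  by apply: RRe_real; exact: (mxOverP (hermitian_spectral_diag_real Ah)).
elim=> [|k IHk].
  rewrite expr0 (_ : diag_mx _ = 1%:M) ?mulmx1 ?UU'//.
  by apply/matrixP => i j; rewrite !mxE expr0.
rewrite exprS IHk {1}AE invmx_unitary // -mulmxE !mulmxA.
rewrite -[X in X *m _ *m _ = _]mulmxA UU mulmx1; congr (_ *m _).
rewrite -mulmxA mulmx_diag; congr (_ *m diag_mx _).
by apply/rowP => j; rewrite !mxE -xE -rmorphM /= exprS.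
Qed.

Lemma mxtrace_conj_diag U B (D : 'rV[R[i]]_d) :
  \tr (B *m (U^h *m diag_mx D *m U)) = \sum_a D 0 a * (U *m B *m U^h) a a.
Proof.
have -> : B *m (U^h *m diag_mx D *m U) = (B *m U^h) *m (diag_mx D *m U).
  by rewrite !mulmxA.
rewrite mxtrace_mulC -[X in \tr X]mulmxA mul_diag_mx mulmxA.
by apply: eq_bigr => a _; rewrite mxE.
Qed.

Lemma psdmx_conj_diag U B a : psdmx B -> 0 <= (U *m B *m U^h) a a.
Proof.
move=> [_ /(_ (row a U)^h)]; rewrite hermK => /le_trans; apply.
rewrite -!row_mul le_eqVlt; apply/orP; left; apply/eqP.
rewrite !mxE; apply: eq_bigr => j _; rewrite !mxE.
by congr (_ * _).
Qed.

(** In the eigenbasis of [X] the trace is a sum of even powers of eigenvalues, weighted by the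
    nonnegative diagonal entries of [B]. *)
Lemma psdmx_retr_exp_ge0 B X n : psdmx B -> X \is hermsymmx -> ~~ odd n ->
  0 <= retr (B *m X ^+ n).
Proof.
move=> Bpsd Xh n_even; have [U [x [_ _ ->]]] := hermitian_spectral Xh.
rewrite mxtrace_conj_diag.
suff: 0 <= \sum_a (\row_j (x j ^+ n)%:C) 0 a * (U *m B *m U^h) a a.
  by rewrite lecE => /andP[].
apply: sumr_ge0 => a _; rewrite mulr_ge0 ?psdmx_conj_diag // mxE ler0c.
exact: exprn_even_ge0.
Qed.

(** With [Z] the matrix of [A] between the eigenbases of [X] and [Y], the weights are the
    [|Z a b|^2]. They do not depend on [k] and [l], so inequalities between such traces reduce to
    inequalities between pairs of real eigenvalues. *)
Lemma retr_mul_spectral A X Y : A \is hermsymmx -> X \is hermsymmx ->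
  Y \is hermsymmx ->
  exists (x y : 'I_d -> R) (w : 'I_d -> 'I_d -> R),
    (forall a b, 0 <= w a b) /\
    forall k l, retr (A *m X ^+ k *m A *m Y ^+ l) =
      \sum_a \sum_b w a b * (x a ^+ k * y b ^+ l).
Proof.
move=> /hermsymmxE Ah Xh Yh.
have [U [x [_ _ XE]]] := hermitian_spectral Xh.
have [V [y [_ _ YE]]] := hermitian_spectral Yh.
pose Z := U *m A *m V^h.
exists x, y, (fun a b => complex.Re (Z a b * (Z a b)^*)); split.
  by move=> a b; have := mulcJ_ge0 (Z a b); rewrite lecE => /andP[].
move=> k l.
have -> : \tr (A *m X ^+ k *m A *m Y ^+ l) = \tr (A *m Y ^+ l *m A *m X ^+ k).
  by rewrite -mulmxA mxtrace_mulC !mulmxA.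
rewrite XE mxtrace_conj_diag raddf_sum; apply: eq_bigr => a _.
have -> : (U *m (A *m Y ^+ l *m A) *m U^h) a a =
    \sum_b (y b ^+ l)%:C * (Z a b * (Z a b)^*).
  have -> : U *m (A *m Y ^+ l *m A) *m U^h =
      Z *m diag_mx (\row_j (y j ^+ l)%:C) *m Z^h.
    by rewrite /Z !mulmx_herm hermK Ah YE !mulmxA.
  rewrite mul_mx_diag mxE; apply: eq_bigr => b _; rewrite !mxE.
  by rewrite mulrAC mulrC.
rewrite mxE mulr_sumr raddf_sum; apply: eq_bigr => b _.
by case: (Z a b) => u v /=; ring.
Qed.

End HermitianMatrices.

(** * Noncommutative Khintchine inequality *)

(** Telescoping with [x] kept on the left and [y] on the right, as the two need not commute. *)
Lemma subrX_noncomm (S : pzRingType) (x y : S) r :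
  x ^+ r - y ^+ r = \sum_(k < r) x ^+ (r.-1 - k) * (x - y) * y ^+ k.
Proof.
elim: r => [|r IHr]; first by rewrite big_ord0 subrr.
rewrite big_ord_recr /= subnn expr0 mul1r.
have -> : x ^+ r.+1 - y ^+ r.+1 = x * (x ^+ r - y ^+ r) + (x - y) * y ^+ r.
  by rewrite mulrBr mulrBl -!exprS addrA subrK.
rewrite IHr mulr_sumr; congr (_ + _); apply: eq_bigr => k _.
rewrite !mulrA -exprS; congr (_ ^+ _ * _ * _).
by case: r k {IHr} => [[]//|r k]; rewrite subSn // -ltnS.
Qed.

(** Evenness of [n] allows passing to absolute values [a], [b]; the claim then reads
    [(b^k - a^k) (b^l - a^l) >= 0] with [l = n - k], and both factors have the same sign. *)
Lemma exprn_cross_le (R : realDomainType) (x y : R) n k : ~~ odd n ->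
  (k <= n)%N -> x ^+ k * y ^+ (n - k) + x ^+ (n - k) * y ^+ k <= x ^+ n + y ^+ n.
Proof.
move=> n_even kn; set l := (n - k)%N.
have nE : n = (k + l)%N by rewrite subnKC.
apply: (@le_trans _ _ (`|x| ^+ k * `|y| ^+ l + `|x| ^+ l * `|y| ^+ k)).
  by apply: lerD; apply: le_trans (ler_norm _) _; rewrite normrM !normrX.
rewrite -(ger0_norm (exprn_even_ge0 x n_even)) normrX.
rewrite -(ger0_norm (exprn_even_ge0 y n_even)) normrX nE !exprD.
have : 0 <= `|x| := normr_ge0 x; have : 0 <= `|y| := normr_ge0 y.
move: `|x| `|y| => a b; wlog ab : a b / a <= b => [W b0 a0|b0 a0].
  have [ab|/ltW ba] := leP a b; first exact: W.
  by rewrite [X in X <= _]addrC [X in _ <= X]addrC [X in X + _ <= _]mulrC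
    [X in _ + X <= _]mulrC; exact: W.
have le_exp i : 0 <= b ^+ i - a ^+ i by rewrite subr_ge0 lerXn2r.
have := mulr_ge0 (le_exp k) (le_exp l); nra.
Qed.

(** Each exponent is paired with its reversal, whence the factor 2 on the left. *)
Lemma sum_exprn_cross_le (R : realDomainType) (x y : R) q :
  2 * \sum_(k < (q.*2).+1) x ^+ (q.*2 - k) * y ^+ k
  <= (q.*2).+1%:R * (x ^+ q.*2 + y ^+ q.*2).
Proof.
rewrite mulr_natl mulr2n {1}(reindex_inj rev_ord_inj) -big_split /=.
rewrite mulr_natl -[X in _ *+ X]card_ord -sumr_const; apply: ler_sum => k _.
rewrite subSS subKn; last by rewrite -ltnS.
by apply: exprn_cross_le; rewrite ?odd_double // -ltnS.
Qed.

Section Khintchine.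
Context (R : realType) (d : nat).
Implicit Types (A B X Y rho U V : 'M[R[i]]_d).

Local Notation "A ^h" := (map_mx Num.conj A^T) (at level 8, format "A ^h").
Local Notation retr A := (complex.Re (\tr A)).

Lemma psdmxD A B : psdmx A -> psdmx B -> psdmx (A + B).
Proof.
move=> [Ah Ap] [Bh Bp]; split.
  by apply: hermP; rewrite linearD /= map_mxD !hermsymmxE.
by move=> v; rewrite mulmxDr mulmxDl mxE addr_ge0.
Qed.

Lemma psdmx_conj A B : psdmx A -> psdmx (B^h *m A *m B).
Proof.
move=> Ap; split; first by apply: hermP; rewrite !mulmx_herm hermK (psdmx_herm Ap) mulmxA.
move=> v; have := Ap.2 (B *m v); rewrite mulmx_herm.
by rewrite !mulmxA.
Qed.

(** With [B = 1 - A], which commutes with [A], one has [1 - A^2 = B + ABA + BAB], a sum of positive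
    semidefinite matrices. *)
Lemma effect_sqr A : effect A -> psdmx (1%:M - A *m A).
Proof.
move=> [Ap Bp]; set B := 1%:M - A in Bp *.
have Ah := psdmx_herm Ap; have Bh := psdmx_herm Bp.
have -> : 1%:M - A *m A = B + (A^h *m B *m A + B^h *m A *m B).
  rewrite Ah Bh; have -> : B *m A = A *m B.
    by rewrite /B mulmxBl mulmxBr mulmx1 mul1mx.
  have AB : A + B = 1%:M by rewrite /B addrC subrK.
  by rewrite -mulmxDr AB mulmx1 {2}/B mulmxBr mulmx1 addrA [B + A]addrC AB.
exact: (psdmxD Bp (psdmxD (psdmx_conj A Bp) (psdmx_conj B Ap))).
Qed.

Lemma effect_herm A : effect A -> A \is hermsymmx.
Proof. by case=> -[]. Qed.

(** Cyclicity turns the left side into [Tr[A^2 X^n]], and [1 - A^2] is positive semidefinite. *)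
Lemma effect_retr_sandwich A X n : effect A -> X \is hermsymmx -> ~~ odd n ->
  retr (A *m X ^+ n *m A) <= retr (X ^+ n).
Proof.
move=> Ae Xh n_even; rewrite mxtrace_mulC mulmxA.
have := psdmx_retr_exp_ge0 (effect_sqr Ae) Xh n_even.
by rewrite mulmxBl mul1mx retrD retrN subr_ge0.
Qed.

(** Telescoping with [X - Y = 2sA] leaves the prefactor [2 s^2 = 2] and a sum of traces
    [Tr[A X^(2q-k) A Y^k]]. In common weights this is a sum over eigenvalue pairs, where
    [sum_exprn_cross_le] removes the mixed powers. *)
Lemma khintchine_increment A X Y (s : R) q : effect A -> X \is hermsymmx ->
  Y \is hermsymmx -> s ^+ 2 = 1 -> X - Y = (2 * s)%:C *: A ->
  s * retr (A *m (X ^+ (q.*2).+1 - Y ^+ (q.*2).+1))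
  <= (q.*2).+1%:R * (retr (X ^+ q.*2) + retr (Y ^+ q.*2)).
Proof.
move=> Ae Xh Yh s1 XY; have Ah := effect_herm Ae.
have [x [y [w [w0 wE]]]] := retr_mul_spectral Ah Xh Yh.
rewrite subrX_noncomm mulmx_sumr retr_sum XY.
under eq_bigr => k _.
  rewrite -!mulmxE -scalemxAr -scalemxAl -scalemxAr !mulmxA retrZ wE.
  over.
rewrite -mulr_sumr mulrA mulrCA -expr2 s1 mulr1 exchange_big mulr_sumr /=.
(* Exponents [2q] and [0] in [wE] sum the weights back to [Tr[A X^(2q) A]]. *)
have leX : \sum_a \sum_b w a b * x a ^+ q.*2 <= retr (X ^+ q.*2).
  apply: le_trans (effect_retr_sandwich Ae Xh (negbT (odd_double q))).
  have := wE q.*2 0; rewrite expr0 mulmx1 => ->.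
  by under [leRHS]eq_bigr do under eq_bigr do rewrite expr0 mulr1.
have leY : \sum_a \sum_b w a b * y b ^+ q.*2 <= retr (Y ^+ q.*2).
  apply: le_trans (effect_retr_sandwich Ae Yh (negbT (odd_double q))).
  rewrite mxtrace_mulC mulmxA; have := wE 0 q.*2; rewrite expr0 mulmx1 => ->.
  by under [leRHS]eq_bigr do under eq_bigr do rewrite expr0 mul1r.
apply: (@le_trans _ _ ((q.*2).+1%:R * (\sum_a \sum_b w a b * x a ^+ q.*2 +
  \sum_a \sum_b w a b * y b ^+ q.*2))); last first.
  exact: (ler_wpM2l (ler0n _ _) (lerD leX leY)).
rewrite -big_split mulr_sumr; apply: ler_sum => a _.
rewrite exchange_big -big_split !mulr_sumr; apply: ler_sum => b _ /=.
rewrite -mulr_sumr mulrCA -mulrDr [X in _ <= X]mulrCA.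
by rewrite ler_wpM2l // sum_exprn_cross_le.
Qed.

Definition sgnb (b : bool) : R := if b then 1 else -1.

Definition signed_sum (n : nat) (A : 'I_n -> 'M[R[i]]_d)
  (e : {ffun 'I_n -> bool}) := \sum_j (sgnb (e j))%:C *: A j.

Definition flip n (j : 'I_n) (e : {ffun 'I_n -> bool}) : {ffun 'I_n -> bool} :=
  [ffun i => if i == j then ~~ e i else e i].

Lemma flipK n (j : 'I_n) : involutive (flip j).
Proof.
by move=> e; apply/ffunP => i; rewrite !ffunE; case: eqP => // _; exact: negbK.
Qed.

Lemma signed_sum_herm n (A : 'I_n -> 'M[R[i]]_d) e : (forall j, effect (A j)) ->
  signed_sum A e \is hermsymmx.
Proof.
move=> Ae; apply: hermP; apply/matrixP => i k.
rewrite mxE mxE !summxE rmorph_sum; apply: eq_bigr => j _.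
have /matrixP/(_ i k) := hermsymmxE (effect_herm (Ae j)).
rewrite !mxE rmorphM => hA; congr (_ * _); last exact: hA.
by rewrite -[LHS]/(conjc _) conjc_real.
Qed.

(* Rademacher integration by parts: Y is X with the j-th sign flipped, and the
   sum over signs of s_j Tr[A_j X^r] is half that of s_j Tr[A_j (X^r - Y^r)],
   which telescopes. *)
Lemma khintchine_step n (A : 'I_n -> 'M[R[i]]_d) q :
  (forall j, effect (A j)) ->
  \sum_(e : {ffun 'I_n -> bool}) retr (signed_sum A e ^+ (q.*2).+2)
  <= (q.*2).+1%:R * n%:R * \sum_(e : {ffun 'I_n -> bool}) retr (signed_sum A e ^+ q.*2).
Proof.
move=> Ae; set r := (q.*2).+1.
have term j : \sum_(e : {ffun 'I_n -> bool}) sgnb (e j) * retr (A j *m signed_sum A e ^+ r)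
    <= r%:R * \sum_(e : {ffun 'I_n -> bool}) retr (signed_sum A e ^+ q.*2).
  rewrite -(@ler_pM2l _ 2) //.
  have -> : 2 * \sum_(e : {ffun 'I_n -> bool}) sgnb (e j) * retr (A j *m signed_sum A e ^+ r) =
     \sum_(e : {ffun 'I_n -> bool}) sgnb (e j) *
       retr (A j *m (signed_sum A e ^+ r - signed_sum A (flip j e) ^+ r)).
    under [RHS]eq_bigr do rewrite mulmxBr retrD retrN mulrDr.
    rewrite big_split /= mulr_natl mulr2n; congr (_ + _).
    rewrite (reindex_inj (inv_inj (flipK j))); apply: eq_bigr => e _.
    by rewrite mulrN -mulNr !ffunE eqxx; case: (e j); rewrite /= ?opprK.
  have -> : 2 * (r%:R * \sum_(e : {ffun 'I_n -> bool}) retr (signed_sum A e ^+ q.*2)) =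
     \sum_(e : {ffun 'I_n -> bool}) r%:R *
       (retr (signed_sum A e ^+ q.*2) + retr (signed_sum A (flip j e) ^+ q.*2)).
    rewrite -mulr_sumr big_split /=; rewrite [X in _ = _ * (_ + X)](_ : _ =
      \sum_(e : {ffun 'I_n -> bool}) retr (signed_sum A e ^+ q.*2)); first by ring.
    by rewrite [RHS](reindex_inj (inv_inj (flipK j))).
  apply: ler_sum => e _; apply: khintchine_increment; rewrite ?signed_sum_herm //.
    by case: (e j); rewrite /= ?sqrrN expr1n.
  rewrite /signed_sum -sumrB (bigD1 j) //= big1 ?addr0; last first.
    by move=> i /negbTE ij; rewrite ffunE ij subrr.
  rewrite ffunE eqxx -scalerBl -rmorphB; congr (_%:C *: _).
  by case: (e j) => /=; rewrite ?opprK; ring.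
have -> : \sum_(e : {ffun 'I_n -> bool}) retr (signed_sum A e ^+ r.+1) =
   \sum_j \sum_(e : {ffun 'I_n -> bool}) sgnb (e j) * retr (A j *m signed_sum A e ^+ r).
  rewrite exchange_big; apply: eq_bigr => e _ /=.
  rewrite exprS -mulmxE {1}/signed_sum mulmx_suml retr_sum.
  by apply: eq_bigr => j _; rewrite -scalemxAl retrZ.
rewrite mulrAC mulr_natr -[X in _ *+ X]card_ord -sumr_const.
by apply: ler_sum => j _; exact: term.
Qed.

Lemma retr1 : retr (1%:M : 'M[R[i]]_d) = d%:R.
Proof. by rewrite mxtrace1 -(rmorph_nat (real_complex R)). Qed.

Lemma retr_exp_even_ge0 X q : X \is hermsymmx -> 0 <= retr (X ^+ q.*2).
Proof.
move=> Xh; have := @psdmx_retr_exp_ge0 _ _ 1%:M X q.*2.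
rewrite mul1mx odd_double; apply=> //.
split; first by apply: hermP; rewrite trmx1 map_mx1.
move=> v; rewrite mulmx1 mxE sumr_ge0 // => a _; rewrite !mxE mulrC.
exact: mul_conjC_ge0.
Qed.

(** Iterates [khintchine_step] starting from [Tr[1] = d]; every factor [2q+1] met on the way is
    bounded by [2p]. *)
Lemma khintchine n (A : 'I_n -> 'M[R[i]]_d) p : (forall j, effect (A j)) ->
  \sum_(e : {ffun 'I_n -> bool}) retr (signed_sum A e ^+ p.*2)
  <= (p.*2 * n)%:R ^+ p * (2 ^ n * d)%:R.
Proof.
move=> Ae; suff H q : (q <= p)%N ->
    \sum_(e : {ffun 'I_n -> bool}) retr (signed_sum A e ^+ q.*2)
    <= (p.*2 * n)%:R ^+ q * (2 ^ n * d)%:R by exact: H.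
elim: q => [_|q IHq qp].
  rewrite !expr0 mul1r; under eq_bigr do rewrite retr1.
  by rewrite sumr_const card_ffun card_bool card_ord natrM mulr_natl.
apply: le_trans (khintchine_step _ Ae) _.
rewrite exprS -[leRHS]mulrA; apply: le_trans _ (ler_wpM2l (ler0n _ _) (IHq (ltnW qp))).
rewrite natrM; apply: ler_wpM2r.
  by apply: sumr_ge0 => e _; exact: retr_exp_even_ge0 (signed_sum_herm e Ae).
apply: ler_wpM2r => //; rewrite ler_nat.
by apply: (@leq_trans q.+1.*2); rewrite ?leq_double // doubleS.
Qed.

End Khintchine.

(** * States and effects *)

Section States.
Context (R : realType) (d : nat).
Implicit Types (A B X Y rho U V : 'M[R[i]]_d).

Local Notation "A ^h" := (map_mx Num.conj A^T) (at level 8, format "A ^h").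
Local Notation retr A := (complex.Re (\tr A)).

Lemma Re_ge0 (x : R[i]) : 0 <= x -> 0 <= complex.Re x.
Proof. by rewrite lecE => /andP[]. Qed.

Lemma Re_sum (I : Type) (r : seq I) (Q : pred I) (F : I -> R[i]) :
  complex.Re (\sum_(i <- r | Q i) F i) = \sum_(i <- r | Q i) complex.Re (F i).
Proof. by elim/big_rec2: _ => // i y1 y2 _ <-; case: (F i) y2 => ? ? []. Qed.

Lemma ReM (a : R) (x : R[i]) : complex.Re (a%:C * x) = a * complex.Re x.
Proof. by case: x => u v /=; rewrite mul0r subr0. Qed.

Lemma psdmx_spectral A : psdmx A ->
  exists (U : 'M[R[i]]_d) (x : 'I_d -> R),
    [/\ U *m U^h = 1%:M, U^h *m U = 1%:M, forall a, 0 <= x a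
      & A = U^h *m diag_mx (\row_j (x j)%:C) *m U].
Proof.
move=> Ap; have [U [x [UU UU' AE]]] := hermitian_spectral Ap.1.
have {}AE : A = U^h *m diag_mx (\row_j (x j)%:C) *m U := AE 1%N.
exists U, x; split => // a.
have := psdmx_conj_diag U a Ap; rewrite {1}AE !mulmxA UU mul1mx.
by rewrite -mulmxA UU mulmx1 !mxE eqxx mulr1n ler0c.
Qed.

Lemma psdmx_retr_mul_ge0 A B : psdmx A -> psdmx B -> 0 <= retr (A *m B).
Proof.
move=> Ap Bp; have [U [x [_ _ x0 ->]]] := psdmx_spectral Bp.
rewrite mxtrace_conj_diag; apply: Re_ge0; apply: sumr_ge0 => a _.
by apply: mulr_ge0; [rewrite mxE ler0c | exact: psdmx_conj_diag].
Qed.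

Lemma prob_outcome_itv E rho : effect E -> state rho ->
  0 <= prob_outcome E rho <= 1.
Proof.
move=> [Ep E1p] [rp r1]; rewrite psdmx_retr_mul_ge0 //= -subr_ge0.
have := psdmx_retr_mul_ge0 E1p rp.
by rewrite mulmxBl mul1mx retrD retrN r1.
Qed.

Lemma psdmx_diag U (x : 'I_d -> R) : (forall a, 0 <= x a) ->
  psdmx (U^h *m diag_mx (\row_j (x j)%:C) *m U).
Proof.
move=> x0; apply: psdmx_conj; split.
  apply: hermP; apply/matrixP => i j; rewrite !mxE eq_sym.
  case: eqVneq => [->|_]; last by rewrite mulr0n rmorph0.
  by rewrite mulr1n -[LHS]/(conjc _) conjc_real.
move=> v; rewrite mul_mx_diag mxE sumr_ge0 // => a _; rewrite !mxE mulrAC.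
by rewrite mulr_ge0 ?ler0c // mulrC mul_conjC_ge0.
Qed.

(** The eigenvalues are nonnegative with sum 1, hence at most 1. Entry bounds for effects thereby
    apply to states. *)
Lemma state_effect rho : state rho -> effect rho.
Proof.
move=> [rp r1]; split; first exact: rp.
have [U [x [UU UU' x0 rE]]] := psdmx_spectral rp.
have sx : \sum_a x a = 1.
  apply: complexI; rewrite -[RHS]r1 rE mxtrace_mulC mulmxA UU mul1mx.
  rewrite mxtrace_diag rmorph_sum; apply: eq_bigr => a _; first by rewrite mxE.
have -> : 1%:M - rho = U^h *m diag_mx (\row_j (1 - x j)%:C) *m U.
  rewrite (_ : diag_mx _ = 1%:M - diag_mx (\row_j (x j)%:C)).
    by rewrite mulmxBr mulmxBl mulmx1 UU' -rE.
  apply/matrixP => i j; rewrite !mxE rmorphB /=.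
  by case: eqP => // _; rewrite ?mulr1n // !mulr0n subrr.
apply: psdmx_diag => a; rewrite subr_ge0 -sx (bigD1 a) //= lerDl.
by apply: sumr_ge0.
Qed.

(** The diagonal entry of [1 - A^2] at [i] is [1 - \sum_k |A i k|^2], and it is nonnegative. *)
Lemma effect_entry_le1 A i j : effect A ->
  `|complex.Re (A i j)| <= 1 /\ `|complex.Im (A i j)| <= 1.
Proof.
move=> Ae; have := Re_ge0 (psdmx_conj_diag 1%:M i (effect_sqr Ae)).
rewrite trmx1 map_mx1 mulmx1 mul1mx !mxE eqxx.
rewrite (_ : \sum_k _ = \sum_k A i k * conjc (A i k)); last first.
  apply: eq_bigr => k _; congr (_ * _).
  by have /matrixP/(_ k i) := psdmx_herm Ae.1; rewrite !mxE => <-.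
rewrite raddfB /= subr_ge0 Re_sum (bigD1 j) //= => le1.
have {le1} : complex.Re (A i j * conjc (A i j)) <= 1.
  apply: le_trans le1; rewrite lerDl sumr_ge0 // => k _.
  by apply: Re_ge0; exact: mulcJ_ge0.
case: (A i j) => u v /= uv1.
by rewrite !ler_norml; split; apply/andP; split; nra.
Qed.

Lemma prob_outcome_lip E rho rho' (delta : R) : effect E ->
  (forall i j, `|complex.Re (rho i j) - complex.Re (rho' i j)| <= delta /\
    `|complex.Im (rho i j) - complex.Im (rho' i j)| <= delta) ->
  `|prob_outcome E rho - prob_outcome E rho'| <= (d * d)%:R * (2 * delta).
Proof.
move=> Ee close.
have probE r : prob_outcome E r = \sum_i \sum_j
    (complex.Re (E i j) * complex.Re (r j i) -
     complex.Im (E i j) * complex.Im (r j i)).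
  rewrite /prob_outcome /mxtrace Re_sum; apply: eq_bigr => i _.
  rewrite mxE Re_sum; apply: eq_bigr => j _.
  by case: (E i j) (r j i) => ? ? [].
rewrite !probE -sumrB natrM -mulrA mulr_natl -[X in _ *+ X]card_ord -sumr_const.
apply: le_trans (ler_norm_sum _ _ _) (ler_sum _ _) => i _.
rewrite mulr_natl -[X in _ *+ X]card_ord -sumr_const -sumrB.
apply: le_trans (ler_norm_sum _ _ _) (ler_sum _ _) => j _.
have [e1 e2] := effect_entry_le1 i j Ee; have [c1 c2] := close j i.
set a := complex.Re (E i j) in e1 *; set b := complex.Im (E i j) in e2 *.
set u := complex.Re (rho j i) in c1 *; set v := complex.Im (rho j i) in c2 *.
set u' := complex.Re (rho' j i) in c1 *; set v' := complex.Im (rho' j i) in c2 *.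
have -> : a * u - b * v - (a * u' - b * v') = a * (u - u') - b * (v - v') by ring.
apply: le_trans (ler_normB _ _) _; rewrite !normrM mulr_natl mulr2n.
by apply: lerD; [move: e1 c1 | move: e2 c2] => h1 h2;
  rewrite -[X in _ <= X]mul1r ler_pM.
Qed.

(** Real and imaginary parts of the entries of a state lie in [[-1, 1]] and are sorted into bins of
    width [eta]. States with the same code are entrywise close, so one hypothesis per attained code
    suffices. *)
Lemma finite_net (W : Type) (hyp : W -> 'M[R[i]]_d) (w0 : W) (delta : R) :
  0 < delta -> (forall w, state (hyp w)) ->
  exists (T : finType) (t0 : T) (rep : T -> W), forall w, exists t, forall E,
    effect E ->
    `|prob_outcome E (hyp w) - prob_outcome E (hyp (rep t))| <= delta.
Proof.
(* Each of the [d^2] entries shifts a probability by at most [2 * eta]; the added 1 keeps the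
   divisor positive even for [d = 0]. *)
move=> delta0 hs; pose eta := delta / ((d * d)%:R * 2 + 1).
have D0 : 0 < (d * d)%:R * 2 + 1 :> R by rewrite ltr_wpDl.
have eta0 : 0 < eta by rewrite divr_gt0.
pose K := (Num.truncn (2 / eta)).+1.
pose bin (x : R) : 'I_K := inord (Num.truncn ((x + 1) / eta)).
have binP x y : `|x| <= 1 -> `|y| <= 1 -> bin x = bin y -> `|x - y| <= eta.
  move=> x1 y1 /(congr1 val).
  have shift0 z : `|z| <= 1 -> 0 <= (z + 1) / eta.
    by rewrite ler_norml => /andP[? ?]; apply: divr_ge0; [lra|exact: ltW].
  have bound z : `|z| <= 1 -> (Num.truncn ((z + 1) / eta) < K)%N.
    move=> z1; rewrite ltnS le_truncn // ler_pM2r ?invr_gt0 //.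
    by move: z1; rewrite ler_norml => /andP[? ?]; lra.
  rewrite /bin /= !inordK ?bound // => tE.
  have /andP[a1 a2] := truncn_itv (shift0 x x1).
  have /andP[b1 b2] := truncn_itv (shift0 y y1).
  have -> : x - y = ((x + 1) / eta - (y + 1) / eta) * eta.
    by rewrite mulrBl !divfK ?gt_eqF //; ring.
  rewrite normrM (gtr0_norm eta0); apply: ler_piMl; first exact: ltW.
  move: a1 a2 b1 b2; rewrite tE -!natr1 => ? ? ? ?.
  by rewrite ler_norml; apply/andP; split; lra.
pose code w : {ffun 'I_d * 'I_d -> 'I_K * 'I_K} :=
  [ffun ij => (bin (complex.Re (hyp w ij.1 ij.2)), bin (complex.Im (hyp w ij.1 ij.2)))].
(* Codes attained by no hypothesis get the default [w0]. *)
pose rep c := if pselect (exists w, code w = c) is left ex then projT1 (cid ex) else w0.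
exists _, (code w0), rep => w; exists (code w) => E Ee.
have cE : code (rep (code w)) = code w.
  by rewrite /rep; case: pselect => [ex|[]]; [case: (cid ex) | exists w].
apply: le_trans (prob_outcome_lip (delta := eta) Ee _) _.
  move=> i j; have [r1 r2] := effect_entry_le1 i j (state_effect (hs w)).
  have [r3 r4] := effect_entry_le1 i j (state_effect (hs (rep (code w)))).
  have /ffunP/(_ (i, j)) := cE; rewrite ffunE [in RHS]ffunE /= => -[b1 b2].
  by split; apply: binP.
rewrite mulrA -[leRHS](@divfK _ ((d * d)%:R * 2 + 1)) ?gt_eqF // -/eta mulrC.
by rewrite ler_pM2l // lerDl.
Qed.

(* [t <= 1 + t ^+ n] avoids taking the 2p-th root of the trace. *)
Lemma signed_retr_le X rho (c : R) p : X \is hermsymmx -> state rho ->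
  0 < c -> (0 < p)%N ->
  retr (X *m rho) <= c * (1 + retr (X ^+ p.*2) / c ^+ p.*2).
Proof.
move=> Xh [rp r1] c0 p0; have [U [x [UU UU' XE]]] := hermitian_spectral Xh.
(* [r] is the distribution of [rho] over the eigenbasis of [X], so the left side is a mean of
   eigenvalues. *)
pose r a := complex.Re ((U *m rho *m U^h) a a).
have r0 a : 0 <= r a by apply: Re_ge0; exact: psdmx_conj_diag.
have sr : \sum_a r a = 1.
  rewrite -Re_sum -[\sum_a _]/(\tr _) -mulmxA mxtrace_mulC -mulmxA UU' mulmx1.
  by rewrite r1.
have trE k : retr (rho *m X ^+ k) = \sum_a x a ^+ k * r a.
  rewrite XE mxtrace_conj_diag Re_sum; apply: eq_bigr => a _.
  by rewrite mxE ReM.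
have trX : retr (X ^+ p.*2) = \sum_a x a ^+ p.*2.
  rewrite XE mxtrace_mulC mulmxA UU mul1mx mxtrace_diag Re_sum.
  by apply: eq_bigr => a _; rewrite mxE.
rewrite mxtrace_mulC -[X in _ *m X]expr1 trE.
apply: (@le_trans _ _ (\sum_a (c * (1 + retr (X ^+ p.*2) / c ^+ p.*2)) * r a)).
  apply: ler_sum => a _; rewrite ler_wpM2r // expr1.
  have xa : x a ^+ p.*2 <= retr (X ^+ p.*2).
    rewrite trX (bigD1 a) //= lerDl sumr_ge0 // => b _.
    by rewrite exprn_even_ge0 // odd_double.
  rewrite mulrC -ler_pdivrMr //; set t := x a / c.
  apply: (@le_trans _ _ (1 + t ^+ p.*2)); last first.
    by rewrite lerD2l /t expr_div_n ler_pM2r // invr_gt0 exprn_gt0.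
  have [t1|t1] := leP t 1.
    by rewrite (le_trans t1) // lerDl exprn_even_ge0 // odd_double.
  rewrite (@le_trans _ _ (t ^+ p.*2)) ?lerDr //.
  by rewrite ler_eXnr ?double_gt0 // ltW.
by rewrite -mulr_sumr sr mulr1.
Qed.

(** [c] is chosen so that [c^(2p) = 2^p (2pn)^p]. The factor [2^p] absorbs the dimension in the
    Khintchine bound, so the normalized moment averages to at most 1 over the signs. *)
Lemma sum_khintchine_le n (A : 'I_n -> 'M[R[i]]_d) p : (forall j, effect (A j)) ->
  (0 < n)%N -> (0 < p)%N -> (d <= 2 ^ p)%N ->
  let c := 2 * Num.sqrt ((p * n)%:R) in
  \sum_(e : {ffun 'I_n -> bool})
    c * (1 + retr (signed_sum A e ^+ p.*2) / c ^+ p.*2) <= 2 ^+ n * (2 * c).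
Proof.
move=> Ae n0 p0 dp /=; set c := 2 * Num.sqrt _.
have c0 : 0 < c by rewrite mulr_gt0 // sqrtr_gt0 ltr0n muln_gt0 p0.
have c2 : c ^+ p.*2 = 2 ^+ p * (p.*2 * n)%:R ^+ p.
  rewrite -mul2n exprM -exprMn; congr (_ ^+ _).
  by rewrite /c exprMn sqr_sqrtr // -mulnA [in RHS]natrM mulrA expr2.
rewrite -mulr_sumr [leRHS]mulrA [leRHS]mulrC ler_pM2l // big_split /=.
rewrite sumr_const card_ffun card_bool card_ord -mulr_suml.
rewrite [leRHS]mulr_natr [leRHS]mulr2n natrX.
rewrite lerD2l ler_pdivrMr ?exprn_gt0 //; apply: le_trans (khintchine p Ae) _.
rewrite c2 [(2 ^ n * d)%:R]natrM natrX mulrCA ler_pM2l ?exprn_gt0 // mulrC.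
by rewrite ler_wpM2r ?exprn_ge0 // -natrX ler_nat.
Qed.

End States.

(** * Measurement outcomes *)

Section Measurement.
Context (R : realType) (d : nat).
Implicit Types (A B E rho : 'M[R[i]]_d).

Lemma big_enum_val_ord (T : finType) (F : T -> R[i]) :
  \sum_(a < #|T|) F (enum_val a) = \sum_(x : T) F x.
Proof.
rewrite (reindex (@enum_rank T)) /=; last exact: onW_bij (@enum_rank_bij T).
by apply: eq_bigr => x _; rewrite enum_rankK.
Qed.

(** Both sides expand over pairs of index functions [f], [g]. This makes the Born rule factor over
    the copies. *)
Lemma mxtrace_tens (I : finType) (A B : I -> 'M[R[i]]_d) :
  \tr (tens A *m tens B) = \prod_i \tr (A i *m B i).
Proof.
pose F (f g : {ffun I -> 'I_d}) := \prod_i (A i (f i) (g i) * B i (g i) (f i)).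
transitivity (\sum_f \sum_g F f g).
  rewrite -big_enum_val_ord; apply: eq_bigr => a _.
  rewrite -big_enum_val_ord mxE; apply: eq_bigr => b _.
  by rewrite !mxE -big_split.
under [RHS]eq_bigr => i _.
  rewrite /mxtrace; under eq_bigr do rewrite mxE.
  over.
rewrite bigA_distr_bigA; apply: eq_bigr => f _.
by rewrite bigA_distr_bigA.
Qed.

Lemma Im_mxtrace_effect E rho : effect E -> state rho ->
  complex.Im (\tr (E *m rho)) = 0.
Proof.
move=> Ee [rp _]; have : conjc (\tr (E *m rho)) = \tr (E *m rho).
  rewrite -[LHS]/(Num.conj (\tr (E *m rho))) -[in LHS]mxtrace_tr -trace_map_mx.
  by rewrite mulmx_herm (psdmx_herm rp) (psdmx_herm Ee.1) mxtrace_mulC.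
by case: (\tr _) => u v /= [] ?; lra.
Qed.

Lemma mxtrace_povm2 E rho b : effect E -> state rho ->
  \tr (povm2 E b *m rho) =
  (if b then prob_outcome E rho else 1 - prob_outcome E rho)%:C.
Proof.
move=> Ee rs; have Im0 := Im_mxtrace_effect Ee rs.
have trE : \tr (E *m rho) = (prob_outcome E rho)%:C.
  by rewrite /prob_outcome; case: (\tr _) Im0 => u v /= ->.
case: b; rewrite /povm2 // mulmxBl mul1mx raddfB /= rs.2 trE.
by rewrite -[1 in LHS](rmorph1 (real_complex R)) -rmorphB.
Qed.

End Measurement.

(** * Independent Bernoulli variables on a finite index set *)

Section ProductBernoulli.
Context (R : realType) (K : finType) (q : K -> R).
Hypothesis q01 : forall c, 0 <= q c <= 1.

Definition bernw (c : K) (b : bool) : R := if b then q c else 1 - q c.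

Definition bernp (b : {ffun K -> bool}) : R := \prod_c bernw c (b c).

Lemma bernw_ge0 c b : 0 <= bernw c b.
Proof. by have := q01 c; case: b => /andP[] //=; rewrite subr_ge0. Qed.

Lemma bernp_ge0 b : 0 <= bernp b.
Proof. by apply: prodr_ge0 => c _; exact: bernw_ge0. Qed.

Lemma sum_prod_bool (u : K -> bool -> R) :
  \sum_(b : {ffun K -> bool}) \prod_c u c (b c) =
  \prod_c (u c true + u c false).
Proof. by rewrite -bigA_distr_bigA; apply: eq_bigr => c _; rewrite big_bool. Qed.

Lemma sum_bernp : \sum_b bernp b = 1.
Proof. by rewrite sum_prod_bool big1 // => c _; rewrite /= addrC subrK. Qed.

(** By independence distinct centred variables are uncorrelated, and each variance [q (1 - q)] is at
    most 1. *)
Lemma bernp_covariance c1 c2 :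
  \sum_b bernp b * (((b c1)%:R - q c1) * ((b c2)%:R - q c2)) <= (c1 == c2)%:R.
Proof.
pose g c (b : bool) : R := b%:R - q c.
(* Each centred factor is inserted at its own coordinate, which turns the expectation into a
   product; for distinct indices the factor at [c1] vanishes. *)
pose u c b := bernw c b * ((if c == c1 then g c b else 1) *
                           (if c == c2 then g c b else 1)).
have -> : \sum_b bernp b * (((b c1)%:R - q c1) * ((b c2)%:R - q c2)) =
    \prod_c (u c true + u c false).
  rewrite -sum_prod_bool; apply: eq_bigr => b _; rewrite !big_split /=.
  by rewrite -!big_mkcond !big_pred1_eq.
rewrite (bigD1 c1) //= /u eqxx /bernw /g; have /andP[q0 q1] := q01 c1.
have [->|ne] := eqVneq c1 c2.
  rewrite big1; first by have := q01 c2 => /andP[? ?] /=; nra.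
  by move=> c /negbTE ->; ring.
rewrite [X in X * _](_ : _ = 0) ?mul0r //.
by rewrite /=; ring.
Qed.

(** Vanishing covariances give the sum of deviations a second moment of at most [M], and AM-GM turns
    this into a first-moment bound. *)
Lemma bernp_frequency (M : nat) (c : 'I_M -> K) (p : R) : (0 < M)%N ->
  injective c -> (forall l, q (c l) = p) ->
  \sum_b bernp b * `|M%:R^-1 * \sum_(l < M) (b (c l))%:R - p|
  <= 1 / Num.sqrt M%:R.
Proof.
move=> M0 c_inj qc; set t := Num.sqrt M%:R.
have t0 : 0 < t by rewrite sqrtr_gt0 ltr0n.
have tt : t ^+ 2 = M%:R by rewrite sqr_sqrtr.
pose S (b : {ffun K -> bool}) : R := \sum_(l < M) ((b (c l))%:R - p).
have SE (b : {ffun K -> bool}) : M%:R^-1 * \sum_(l < M) (b (c l))%:R - p = S b / t ^+ 2.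
  rewrite /S sumrB sumr_const card_ord mulrBl tt mulrC; congr (_ - _).
  by rewrite -[p *+ M]mulr_natr mulfK // pnatr_eq0 -lt0n.
have S2 : \sum_b bernp b * S b ^+ 2 <= t ^+ 2.
  have -> : \sum_b bernp b * S b ^+ 2 = \sum_(l < M) \sum_(l' < M)
      \sum_b bernp b * (((b (c l))%:R - q (c l)) * ((b (c l'))%:R - q (c l'))).
    under [RHS]eq_bigr do rewrite exchange_big.
    rewrite exchange_big; apply: eq_bigr => b _.
    rewrite expr2 {1}/S mulr_suml mulr_sumr; apply: eq_bigr => l _.
    rewrite mulr_sumr mulr_sumr; apply: eq_bigr => l' _.
    by rewrite !qc.
  rewrite tt -[X in _ <= X%:R]card_ord -sumr_const; apply: ler_sum => l _.
  apply: le_trans (ler_sum _ (fun l' _ => bernp_covariance (c l) (c l'))) _.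
  rewrite (bigD1 l) //= eqxx big1 ?addr0 // => l' /negbTE l'l.
  by rewrite (inj_eq c_inj) eq_sym l'l.
(* AM-GM: [2 |x| <= t x^2 + 1 / t] *)
have young b : `|S b / t ^+ 2| <= (S b ^+ 2 / t ^+ 3 + t^-1) / 2.
  have -> : S b ^+ 2 / t ^+ 3 = (S b / t ^+ 2) ^+ 2 * t.
    by field; rewrite gt_eqF.
  set y := S b / t ^+ 2; rewrite -[y ^+ 2]real_normK ?num_real //.
  have tv : t * t^-1 = 1 by rewrite divff // gt_eqF.
  have := mulr_ge0 (ltW t0) (sqr_ge0 (`|y| - t^-1)).
  have -> : t * (`|y| - t^-1) ^+ 2 = `|y| ^+ 2 * t - 2 * `|y| * (t * t^-1) + t^-1 * (t * t^-1) by ring.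
  rewrite tv; lra.
under eq_bigr do rewrite SE.
apply: (@le_trans _ _ (\sum_b bernp b * ((S b ^+ 2 / t ^+ 3 + t^-1) / 2))).
  by apply: ler_sum => b _; rewrite ler_wpM2l // bernp_ge0.
have -> : \sum_b bernp b * ((S b ^+ 2 / t ^+ 3 + t^-1) / 2) =
   (\sum_b bernp b * S b ^+ 2) * (t ^+ 3)^-1 / 2 + t^-1 / 2 * \sum_b bernp b.
  rewrite !mulr_suml mulr_sumr -big_split; apply: eq_bigr => b _ /=.
  by ring.
rewrite sum_bernp mulr1 div1r.
have : (\sum_b bernp b * S b ^+ 2) * (t ^+ 3)^-1 <= t ^+ 2 * (t ^+ 3)^-1.
  by rewrite ler_wpM2r // invr_ge0 exprn_ge0 // ltW.
have -> : t ^+ 2 * (t ^+ 3)^-1 = t^-1 by field; rewrite gt_eqF.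
by move=> ?; lra.
Qed.

End ProductBernoulli.

(** * The Born rule for the learner's measurement *)

Section Born.
Context (R : realType) (d : nat) (dZ : measure_display) (Z : measurableType dZ).
Variables (E : Z -> 'M[R[i]]_d) (rho0 : 'M[R[i]]_d).
Hypotheses (Ee : forall z, effect (E z)) (rs : state rho0).
Variables (m m_test m_train : nat) (s : (m + m).-tuple Z).

Let q (il : 'I_m * 'I_m_train) : R :=
  prob_outcome (E (tnth (second_half s) il.1)) rho0.

Let born (b : outcomes m m_train) : R := prob_outcome (measurement E m_test s b)
  (tens (fun _ : copies m m_test m_train => rho0)).

(** Each test copy contributes [Tr[rho0] = 1], and the training copies give real factors, so the
    real part of the product is a product of Bernoulli weights. *)
Lemma bornE b : born b = bernp q b.
Proof.
rewrite /born /prob_outcome /measurement mxtrace_tens big_sumType /=.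
rewrite big1 ?mul1r; last by move=> c _; rewrite mul1mx rs.2.
under eq_bigr do rewrite mxtrace_povm2 //.
by rewrite -rmorph_prod.
Qed.

Let q01 c : 0 <= q c <= 1.
Proof. exact: prob_outcome_itv. Qed.

Lemma born_ge0 b : 0 <= born b.
Proof. by rewrite bornE bernp_ge0. Qed.

Lemma sum_born : \sum_b born b = 1.
Proof. by under eq_bigr do rewrite bornE; exact: sum_bernp. Qed.

Lemma born_emp_freq (i : 'I_m) : (0 < m_train)%N ->
  \sum_b born b *
    `|emp_freq R b i - prob_outcome (E (tnth (second_half s) i)) rho0|
  <= 1 / Num.sqrt m_train%:R.
Proof.
move=> M0; under eq_bigr do rewrite bornE.
by apply: (bernp_frequency q01 (c := fun l => (i, l))) => // l l' [].
Qed.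

End Born.

(** * Integrals of bounded random variables *)

(* Every random variable of the argument is bounded, so integrability never has
   to be argued separately. *)
Definition bounded_rv (R : realType) d (T : measurableType d) (f : T -> R) :=
  measurable_fun setT f /\ exists B, forall x, `|f x| <= B.

Section BoundedRV.
Context (R : realType) (d : measure_display) (T : measurableType d).
Implicit Types (f g : T -> R).

Lemma bounded_rv_cst (c : R) : bounded_rv (fun _ : T => c).
Proof. by split; [exact: measurable_cst | exists `|c|]. Qed.

Lemma bounded_rvD f g : bounded_rv f -> bounded_rv g ->
  bounded_rv (fun x => f x + g x).
Proof.
move=> [mf [B fB]] [mg [C gC]]; split; first exact: measurable_funD.
by exists (B + C) => x; apply: le_trans (ler_normD _ _) _; apply: lerD.
Qed.

Lemma bounded_rvM f g : bounded_rv f -> bounded_rv g ->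
  bounded_rv (fun x => f x * g x).
Proof.
move=> [mf [B fB]] [mg [C gC]]; split; first exact: measurable_funM.
by exists (B * C) => x; rewrite normrM; apply: ler_pM.
Qed.

Lemma bounded_rvZ (c : R) f : bounded_rv f -> bounded_rv (fun x => c * f x).
Proof. by move=> bf; apply: bounded_rvM => //; exact: bounded_rv_cst. Qed.

Lemma bounded_rvB f g : bounded_rv f -> bounded_rv g ->
  bounded_rv (fun x => f x - g x).
Proof.
move=> bf bg; rewrite (_ : (fun x => _) = (fun x => f x + (-1) * g x)).
  by apply: bounded_rvD => //; exact: bounded_rvZ.
by apply/funext => x; rewrite mulN1r.
Qed.

Lemma bounded_rv_norm f : bounded_rv f -> bounded_rv (fun x => `|f x|).
Proof.
move=> [mf [B fB]]; split; first exact: measurableT_comp.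
by exists B => x; rewrite normr_id.
Qed.

Lemma bounded_rv_max f g : bounded_rv f -> bounded_rv g ->
  bounded_rv (fun x => Num.max (f x) (g x)).
Proof.
move=> [mf [B fB]] [mg [C gC]]; split; first exact: measurable_maxr.
exists (Num.max B C) => x.
by case: (leP (f x) (g x)) => _; rewrite le_max ?fB ?gC ?orbT.
Qed.

Lemma bounded_rv_sum (I : Type) (r : seq I) (F : I -> T -> R) :
  (forall i, bounded_rv (F i)) -> bounded_rv (fun x => \sum_(i <- r) F i x).
Proof.
move=> bF; elim: r => [|i r IHr].
  by under eq_fun do rewrite big_nil; exact: bounded_rv_cst.
by under eq_fun do rewrite big_cons; exact: bounded_rvD.
Qed.

Lemma bounded_rv_comp d' (T' : measurableType d') (g : T' -> T) f :
  measurable_fun setT g -> bounded_rv f -> bounded_rv (fun x => f (g x)).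
Proof.
by move=> mg [mf [B fB]]; split; [exact: measurableT_comp | exists B].
Qed.

Variable Q : probability T R.

Lemma bounded_rv_integrable f : bounded_rv f -> Q.-integrable setT (EFin \o f).
Proof.
move=> [mf [B fB]]; apply: measurable_bounded_integrable => //.
  exact: fin_num_fun_lty.
exists B; split; [exact: num_real | move=> M BM x _; exact: le_trans (fB x) (ltW BM)].
Qed.

Lemma Rint_cst (c : R) : \int[Q]_x c = c.
Proof. by rewrite Rintegral_cst //= probability_setT mulr1. Qed.

Lemma RintD f g : bounded_rv f -> bounded_rv g ->
  \int[Q]_x (f x + g x) = \int[Q]_x f x + \int[Q]_x g x.
Proof. by move=> bf bg; rewrite RintegralD //; exact: bounded_rv_integrable. Qed.

Lemma RintZ (c : R) f : bounded_rv f -> \int[Q]_x (c * f x) = c * \int[Q]_x f x.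
Proof. by move=> bf; rewrite RintegralZl //; exact: bounded_rv_integrable. Qed.

Lemma le_Rint f g : bounded_rv f -> bounded_rv g -> (forall x, f x <= g x) ->
  \int[Q]_x f x <= \int[Q]_x g x.
Proof.
by move=> bf bg fg; apply: le_Rintegral => //; exact: bounded_rv_integrable.
Qed.

Lemma Rint_sum (I : Type) (r : seq I) (F : I -> T -> R) :
  (forall i, bounded_rv (F i)) ->
  \int[Q]_x (\sum_(i <- r) F i x) = \sum_(i <- r) \int[Q]_x F i x.
Proof.
move=> bF; elim: r => [|i r IHr].
  by rewrite big_nil; under eq_Rintegral do rewrite big_nil; exact: Rint_cst.
rewrite big_cons -IHr -RintD //; last exact: bounded_rv_sum.
by apply: eq_Rintegral => x _; rewrite big_cons.
Qed.

Lemma Rint_norm_le f (B : R) : bounded_rv f -> (forall x, `|f x| <= B) ->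
  `|\int[Q]_x f x| <= B.
Proof.
move=> bf fB; have bB := bounded_rv_cst B; have bB' := bounded_rv_cst (- B).
rewrite ler_norml -{1}(Rint_cst (- B)) -{2}(Rint_cst B).
by rewrite !le_Rint // => x; have := fB x; rewrite ler_norml => /andP[].
Qed.

(* The library's [ge0_le_integral] asks for measurability of the smaller
   function, which is not needed since the integral of a nonnegative function
   is a supremum over simple functions below it. *)
Lemma ge0_le_Rint f g : (forall x, 0 <= f x <= g x) -> bounded_rv g ->
  \int[Q]_x f x <= \int[Q]_x g x.
Proof.
move=> fg bg; have f0 x : 0 <= f x by case/andP: (fg x).
have g0 x : 0 <= g x by case/andP: (fg x) => /le_trans; apply.
have le_fg : (\int[Q]_x (f x)%:E <= \int[Q]_x (g x)%:E)%E.
  rewrite !ge0_integralTE; [|by move=> x; rewrite lee_fin..].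
  apply: ereal_sup_le => y /= [h hf <-]; exists h => // x.
  by apply: le_trans (hf x) _; rewrite lee_fin; case/andP: (fg x).
have int0 : (0 <= \int[Q]_x (f x)%:E)%E by apply: integral_ge0 => x _; rewrite lee_fin.
have gfin := integrable_fin_num measurableT (bounded_rv_integrable bg).
rewrite /Rintegral fine_le // ge0_fin_numE //.
apply: le_lt_trans le_fg _; rewrite -ge0_fin_numE //.
by apply: integral_ge0 => x _; rewrite lee_fin.
Qed.

End BoundedRV.

(** * Fubini's theorem for bounded random variables *)

Section Fubini.
Context (R : realType) (d1 d2 : measure_display).
Context (X : measurableType d1) (Y : measurableType d2).
Variables (Q1 : probability X R) (Q2 : probability Y R).
Variable F : X * Y -> R.
Hypothesis bF : bounded_rv F.

Lemma bounded_rv_sec1 x : bounded_rv (fun y => F (x, y)).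
Proof. by apply: (bounded_rv_comp _ bF); exact: pair1_measurable. Qed.

Lemma bounded_rv_sec2 y : bounded_rv (fun x => F (x, y)).
Proof. by apply: (bounded_rv_comp _ bF); exact: pair2_measurable. Qed.

Let iF := bounded_rv_integrable (Q1 \x Q2)%E bF.

Let sec1E x : (\int[Q2]_y (F (x, y))%:E = (\int[Q2]_y F (x, y))%:E)%E.
Proof.
rewrite fineK //; apply: integrable_fin_num => //.
exact: bounded_rv_integrable (bounded_rv_sec1 x).
Qed.

Let sec2E y : (\int[Q1]_x (F (x, y))%:E = (\int[Q1]_x F (x, y))%:E)%E.
Proof.
rewrite fineK //; apply: integrable_fin_num => //.
exact: bounded_rv_integrable (bounded_rv_sec2 y).
Qed.

Lemma bounded_rv_Rint1 : bounded_rv (fun x => \int[Q2]_y F (x, y)).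
Proof.
split; last first.
  have [_ [B FB]] := bF; exists B => x.
  by apply: Rint_norm_le => //; exact: bounded_rv_sec1.
have := measurable_fubini_F iF; rewrite /fubini_F /=.
under eq_fun do rewrite sec1E.
by move/measurable_EFinP.
Qed.

Lemma bounded_rv_Rint2 : bounded_rv (fun y => \int[Q1]_x F (x, y)).
Proof.
split; last first.
  have [_ [B FB]] := bF; exists B => y.
  by apply: Rint_norm_le => //; exact: bounded_rv_sec2.
have := measurable_fubini_G iF; rewrite /fubini_G /=.
under eq_fun do rewrite sec2E.
by move/measurable_EFinP.
Qed.

Lemma Rint_prod1 : \int[(Q1 \x Q2)%E]_xy F xy = \int[Q1]_x \int[Q2]_y F (x, y).
Proof.
rewrite {1}/Rintegral -(integral12_prod_meas1 iF) /fubini_F /=.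
by under eq_integral do rewrite sec1E.
Qed.

Lemma Rint_prod2 : \int[(Q1 \x Q2)%E]_xy F xy = \int[Q2]_y \int[Q1]_x F (x, y).
Proof.
rewrite {1}/Rintegral -(integral21_prod_meas1 iF) /fubini_G /=.
by under eq_integral do rewrite sec2E.
Qed.

End Fubini.

Lemma Rint_iid_lawS (R : realType) d (Z : measurableType d) (P : probability Z R)
    n (F : n.+1.-tuple Z -> R) : bounded_rv F ->
  \int[iid_law P n.+1]_s F s =
  \int[(P \x iid_law P n)%E]_zs F (cons_pair zs).
Proof.
move=> bF; rewrite /Rintegral; congr fine.
have bFc : bounded_rv (fun zs : Z * n.-tuple Z => F (cons_pair zs)).
  by apply: (bounded_rv_comp _ bF); exact: measurable_cons_pair.
rewrite /= integral_distribution //.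
  by apply/measurable_EFinP; case: bF.
exact: bounded_rv_integrable.
Qed.

(** * Symmetrization and contraction *)

Section FiniteMax.
Context (R : realType) (I : finType) (i0 : I).

(** The seed [a i0] is itself a value of [a], so this is the exact maximum, whatever the sign of the
    values. *)
Definition fmax (a : I -> R) : R := \big[Num.max/a i0]_i a i.

Lemma fmax_ge a i : a i <= fmax a.
Proof. exact: le_bigmax. Qed.

Lemma fmax_le a K : (forall i, a i <= K) -> fmax a <= K.
Proof. by move=> aK; apply: bigmax_le. Qed.

Lemma fmaxD_le a b K : (forall i k, a i + b k <= K) -> fmax a + fmax b <= K.
Proof.
move=> abK; rewrite -lerBrDr; apply: fmax_le => i.
by rewrite lerBrDr addrC -lerBrDr; apply: fmax_le => k; rewrite lerBrDr addrC.
Qed.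

Lemma bounded_rv_fmax d (T : measurableType d) (F : I -> T -> R) :
  (forall i, bounded_rv (F i)) -> bounded_rv (fun x => fmax (F ^~ x)).
Proof.
move=> bF; rewrite /fmax.
elim: (index_enum I) => [|i r IHr].
  by under eq_fun do rewrite big_nil; exact: bF.
by under eq_fun do rewrite big_cons; exact: bounded_rv_max.
Qed.

(** Let [i] and [k] index the two maxima on the left. The map [t -> c |t - q|] is 1-Lipschitz, so
    their terms differ by at most [|p i - p k|]; on the right the plus sign goes to whichever index
    has the larger [p]. The target [q] disappears. *)
Lemma fmax_contraction (a p : I -> R) (q c : R) : `|c| <= 1 ->
  fmax (fun i => a i + 2 * (c * `|p i - q|)) +
  fmax (fun i => a i - 2 * (c * `|p i - q|)) <=
  fmax (fun i => a i + 2 * p i) + fmax (fun i => a i - 2 * p i).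
Proof.
move=> c1; apply: fmaxD_le => i k.
have lip : c * `|p i - q| - c * `|p k - q| <= `|p i - p k|.
  rewrite -mulrBr; apply: le_trans (ler_norm _) _; rewrite normrM.
  apply: (@le_trans _ _ (`| `|p i - q| - `|p k - q| |)); first by rewrite ler_piMl.
  apply: le_trans (ler_dist_dist _ _) _.
  by rewrite (_ : p i - q - (p k - q) = p i - p k) //; ring.
have Mi := fmax_ge (fun i => a i + 2 * p i) i.
have Mk := fmax_ge (fun i => a i - 2 * p i) k.
have Mk' := fmax_ge (fun i => a i + 2 * p i) k.
have Mi' := fmax_ge (fun i => a i - 2 * p i) i.
rewrite /= in Mi Mk Mi' Mk'.
by move: lip; case: (ger0P (p i - p k)) => h lip; lra.
Qed.

End FiniteMax.

Section SignVectors.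
Context (R : realType).

Definition sign_cons n (b : bool) (e : {ffun 'I_n -> bool}) :
  {ffun 'I_n.+1 -> bool} :=
  [ffun i => if unlift ord0 i is Some j then e j else b].

Lemma sum_sign_cons n (G : {ffun 'I_n.+1 -> bool} -> R) :
  \sum_e G e =
  \sum_(e : {ffun 'I_n -> bool}) (G (sign_cons true e) + G (sign_cons false e)).
Proof.
pose f (be : bool * {ffun 'I_n -> bool}) := sign_cons be.1 be.2.
have f_bij : bijective f.
  exists (fun e : {ffun 'I_n.+1 -> bool} => (e ord0, [ffun j => e (lift ord0 j)])).
    move=> [b e]; rewrite /f /= ffunE unlift_none; congr (_, _).
    by apply/ffunP => j; rewrite !ffunE liftK.
  move=> e; apply/ffunP => i; rewrite /f ffunE /=.
  by case: (unliftP ord0 i) => [j ->|->] //; rewrite ffunE.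
rewrite (reindex f) /=; last exact: onW_bij f_bij.
rewrite -(pair_bigA _ (fun b e => G (sign_cons b e))) /= big_bool -big_split.
by [].
Qed.

End SignVectors.

(** * Expected uniform deviation of absolute losses *)

Section UniformDeviation.
Context (R : realType) (dZ : measure_display) (Z : measurableType dZ).
Variables (P : probability Z R) (I : finType) (i0 : I).
Variables (p : I -> Z -> R) (q : Z -> R).
Hypotheses (bp : forall i, bounded_rv (p i)) (bq : bounded_rv q).

Let f (i : I) (z : Z) : R := `|p i z - q z|.

Let bf i : bounded_rv (f i).
Proof. by apply: bounded_rv_norm; exact: bounded_rvB. Qed.

(** The weight [c] will be 0, 1 or -1: it selects a half of the sample and a direction of
    deviation. *)
Definition centered (c : R) i z : R := c * (\int[P]_y f i y - f i z).

Lemma bounded_rv_centered c i : bounded_rv (centered c i).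
Proof.
by apply: bounded_rvZ; apply: bounded_rvB => //; exact: bounded_rv_cst.
Qed.

(* By convexity of the maximum, the centred term is dominated by the average of
   its values at two independent draws, taken with opposite signs. *)
Lemma symmetrization_step (a : I -> R) (c : R) : `|c| <= 1 ->
  \int[P]_z fmax i0 (fun i => a i + centered c i z) <=
  2^-1 * \int[P]_z (fmax i0 (fun i => a i + 2 * p i z) +
                    fmax i0 (fun i => a i - 2 * p i z)).
Proof.
move=> c1.
pose Mp z := fmax i0 (fun i => a i + 2 * (c * f i z)).
pose Mn z := fmax i0 (fun i => a i - 2 * (c * f i z)).
have bMp : bounded_rv Mp.
  apply: bounded_rv_fmax => i; apply: bounded_rvD; first exact: bounded_rv_cst.
  by do 2 apply: bounded_rvZ.
have bMn : bounded_rv Mn.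
  apply: bounded_rv_fmax => i; apply: bounded_rvB; first exact: bounded_rv_cst.
  by do 2 apply: bounded_rvZ.
have bC : bounded_rv (fun z => fmax i0 (fun i => a i + centered c i z)).
  apply: bounded_rv_fmax => i; apply: bounded_rvD; first exact: bounded_rv_cst.
  exact: bounded_rv_centered.
have b2p s : bounded_rv (fun z => fmax i0 (fun i => a i + s * p i z)).
  apply: bounded_rv_fmax => i; apply: bounded_rvD; first exact: bounded_rv_cst.
  exact: bounded_rvZ.
have b2p' : bounded_rv (fun z => fmax i0 (fun i => a i - 2 * p i z)).
  apply: bounded_rv_fmax => i; apply: bounded_rvB; first exact: bounded_rv_cst.
  exact: bounded_rvZ.
apply: (@le_trans _ _ (\int[P]_z (2^-1 * (\int[P]_y Mp y + Mn z)))).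
  apply: le_Rint => //.
    by apply: bounded_rvZ; apply: bounded_rvD => //; exact: bounded_rv_cst.
  move=> z; apply: fmax_le => i.
  have -> : a i + centered c i z = 2^-1 * ((a i + 2 * (c * \int[P]_y f i y)) +
      (a i - 2 * (c * f i z))) by rewrite /centered; field.
  rewrite ler_pM2l ?invr_gt0 // lerD //; last first.
    exact: (fmax_ge i0 (fun i => a i - 2 * (c * f i z))).
  have bfi : bounded_rv (fun y => 2 * (c * f i y)) by do 2 apply: bounded_rvZ.
  rewrite -[X in X + _](Rint_cst P) -RintZ // -RintZ; last exact: bounded_rvZ.
  rewrite -RintD //; last exact: bounded_rv_cst.
  apply: le_Rint => //; first by apply: bounded_rvD => //; exact: bounded_rv_cst.
  by move=> y; exact: (fmax_ge i0 (fun i => a i + 2 * (c * f i y))).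
rewrite RintZ; last by apply: bounded_rvD => //; exact: bounded_rv_cst.
rewrite ler_pM2l ?invr_gt0 // [leLHS]RintD //; last exact: bounded_rv_cst.
rewrite Rint_cst -RintD //; apply: le_Rint; try exact: bounded_rvD.
by move=> z; exact: fmax_contraction.
Qed.

(** Rademacher average with an offset [a] that carries the coordinates already treated in the
    induction; the factor 2 is the cost of symmetrization. *)
Definition rademacher n (a : I -> R) (s : n.-tuple Z) : R :=
  2^-1 ^+ n * \sum_(e : {ffun 'I_n -> bool})
    fmax i0 (fun i => a i + 2 * \sum_(j < n) sgnb R (e j) * p i (tnth s j)).

Lemma rademacher_cons n (a : I -> R) z (s : n.-tuple Z) :
  rademacher a (cons_pair (z, s)) =
  2^-1 * (rademacher (fun i => a i + 2 * p i z) s +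
          rademacher (fun i => a i - 2 * p i z) s).
Proof.
rewrite /rademacher sum_sign_cons exprS -mulrA; congr (_ * _).
rewrite -mulrDr -big_split; congr (_ * _); apply: eq_bigr => e _ /=.
congr (_ + _); congr (fmax i0 _); apply/funext => i; rewrite big_ord_recl /=.
  rewrite ffunE unlift_none /= mul1r mulrDr addrA; congr (_ + _ * _).
  by apply: eq_bigr => j _; rewrite ffunE liftK tnthS.
rewrite ffunE unlift_none /= mulN1r mulrDr mulrN addrA; congr (_ + _ * _).
by apply: eq_bigr => j _; rewrite ffunE liftK tnthS.
Qed.

Lemma bounded_rv_rademacher n d (T : measurableType d) (a : I -> T -> R)
    (g : T -> n.-tuple Z) : (forall i, bounded_rv (a i)) ->
  measurable_fun setT g -> bounded_rv (fun t => rademacher (a ^~ t) (g t)).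
Proof.
move=> ba mg; apply: bounded_rvZ; apply: bounded_rv_sum => e.
apply: bounded_rv_fmax => i; apply: bounded_rvD => //; apply: bounded_rvZ.
apply: bounded_rv_sum => j; apply: bounded_rvZ.
apply: (bounded_rv_comp (g := fun t => tnth (g t) j)) => //.
exact: measurableT_comp (measurable_tnth j) mg.
Qed.

Definition deviation n (c : nat -> R) (a : I -> R) (s : n.-tuple Z) : R :=
  fmax i0 (fun i => a i + \sum_(j < n) centered (c j) i (tnth s j)).

Lemma bounded_rv_deviation n c d (T : measurableType d) (a : I -> T -> R)
    (g : T -> n.-tuple Z) : (forall i, bounded_rv (a i)) ->
  measurable_fun setT g -> bounded_rv (fun t => deviation c (a ^~ t) (g t)).
Proof.
move=> ba mg; apply: bounded_rv_fmax => i; apply: bounded_rvD => //.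
apply: bounded_rv_sum => j.
apply: (bounded_rv_comp (g := fun t => tnth (g t) j)).
  exact: measurableT_comp (measurable_tnth j) mg.
exact: bounded_rv_centered.
Qed.

Lemma deviation_cons n c (a : I -> R) z (s : n.-tuple Z) :
  deviation c a (cons_pair (z, s)) =
  deviation (fun j => c j.+1) (fun i => a i + centered (c 0%N) i z) s.
Proof.
congr (fmax i0 _); apply/funext => i; rewrite big_ord_recl addrA.
by congr (_ + _); apply: eq_bigr => j _; rewrite tnthS.
Qed.

(** Induction on the sample size with [a] and [c] arbitrary. With the first draw fixed, the
    induction hypothesis puts signs on the others; with those fixed, [symmetrization_step] treats
    the first draw for each sign vector. *)
Lemma Rint_deviation_le n (c : nat -> R) (a : I -> R) : (forall j, `|c j| <= 1) ->
  \int[iid_law P n]_s deviation c a s <= \int[iid_law P n]_s rademacher a s.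
Proof.
elim: n c a => [|n IHn] c a c1.
  rewrite le_eqVlt; apply/orP; left; apply/eqP; apply: eq_Rintegral => s _.
  rewrite /rademacher expr0 mul1r (eq_bigr (fun=> fmax i0 a)); last first.
    by move=> e _; congr (fmax i0 _); apply/funext => i; rewrite big_ord0 mulr0 addr0.
  rewrite sumr_const card_ffun card_ord expn0 mulr1n.
  by congr (fmax i0 _); apply/funext => i; rewrite big_ord0 addr0.
have mid k : measurable_fun setT (@id (k.-tuple Z)) by exact: measurable_id.
have bc i : bounded_rv (fun z => a i + centered (c 0%N) i z).
  by apply: bounded_rvD; [exact: bounded_rv_cst | exact: bounded_rv_centered].
have b1 (i : I) : bounded_rv (fun _ : n.+1.-tuple Z => a i) by exact: bounded_rv_cst.
rewrite !Rint_iid_lawS; last 2 first.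
- exact: (bounded_rv_rademacher (g := id)).
- exact: (bounded_rv_deviation _ (g := id)).
pose F (zs : Z * n.-tuple Z) := deviation (fun j => c j.+1)
  (fun i => a i + centered (c 0%N) i zs.1) zs.2.
pose H (zs : Z * n.-tuple Z) :=
  rademacher (fun i => a i + centered (c 0%N) i zs.1) zs.2.
pose G (zs : Z * n.-tuple Z) :=
  2^-1 * (rademacher (fun i => a i + 2 * p i zs.1) zs.2 +
          rademacher (fun i => a i - 2 * p i zs.1) zs.2).
have bF : bounded_rv F.
  apply: bounded_rv_deviation => // i.
  exact: (bounded_rv_comp (@measurable_fst _ _ _ _) (bc i)).
have bH : bounded_rv H.
  apply: bounded_rv_rademacher => // i.
  exact: (bounded_rv_comp (@measurable_fst _ _ _ _) (bc i)).
have bp1 i : bounded_rv (fun zs : Z * n.-tuple Z => 2 * p i zs.1).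
  by apply: bounded_rvZ; exact: (bounded_rv_comp (@measurable_fst _ _ _ _) (bp i)).
have bG : bounded_rv G.
  apply: bounded_rvZ; apply: bounded_rvD; apply: bounded_rv_rademacher => // i.
    by apply: bounded_rvD => //; exact: bounded_rv_cst.
  by apply: bounded_rvB => //; exact: bounded_rv_cst.
rewrite (eq_Rintegral _ (g := F)); last by move=> [z s] _; rewrite deviation_cons.
rewrite [leRHS](eq_Rintegral _ (g := G)); last by move=> [z s] _; rewrite rademacher_cons.
(* [H] is the hybrid in which the first coordinate is still centred and the others carry signs. *)
apply: (@le_trans _ _ (\int[(P \x iid_law P n)%E]_zs H zs)).
  rewrite !Rint_prod1 //.
  apply: le_Rint; [exact: (bounded_rv_Rint1 P (iid_law P n) bF)
                  |exact: (bounded_rv_Rint1 P (iid_law P n) bH)|].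
  move=> z; exact: (IHn (fun j => c j.+1)
    (fun i => a i + centered (c 0%N) i z) (fun j => c1 j.+1)).
(* From [H] to [G] the first draw is integrated innermost, the signed sum of the others being frozen
   into the offset. *)
rewrite !Rint_prod2 //.
apply: le_Rint; [exact: (bounded_rv_Rint2 P (iid_law P n) bH)
                |exact: (bounded_rv_Rint2 P (iid_law P n) bG)|].
move=> s; rewrite /H /G /rademacher /=.
pose v (e : {ffun 'I_n -> bool}) i := 2 * \sum_(j < n) sgnb R (e j) * p i (tnth s j).
pose K (e : {ffun 'I_n -> bool}) z := fmax i0 (fun i => a i + v e i + centered (c 0%N) i z).
pose K' (e : {ffun 'I_n -> bool}) z := fmax i0 (fun i => a i + v e i + 2 * p i z) +
   fmax i0 (fun i => a i + v e i - 2 * p i z).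
have bK e : bounded_rv (K e).
  apply: bounded_rv_fmax => i; apply: bounded_rvD; first exact: bounded_rv_cst.
  exact: bounded_rv_centered.
have bK' e : bounded_rv (K' e).
  apply: bounded_rvD; apply: bounded_rv_fmax => i.
    by apply: bounded_rvD; [exact: bounded_rv_cst | exact: bounded_rvZ].
  by apply: bounded_rvB; [exact: bounded_rv_cst | exact: bounded_rvZ].
rewrite (eq_Rintegral _ (g := fun z => 2^-1 ^+ n * \sum_e K e z)); last first.
  move=> z _; congr (_ * _); apply: eq_bigr => e _; congr (fmax i0 _).
  by apply/funext => i; rewrite addrAC.
rewrite [leRHS](eq_Rintegral _ (g := fun z => 2^-1 ^+ n * \sum_e (2^-1 * K' e z))); last first.
  move=> z _; rewrite -mulrDr mulrCA -mulr_sumr -big_split; congr (_ * (_ * _)).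
  by apply: eq_bigr => e _; congr (fmax i0 _ + fmax i0 _); apply/funext => i;
    rewrite addrAC.
rewrite !RintZ; last 2 first.
- by apply: bounded_rv_sum => e; exact: bounded_rvZ.
- exact: bounded_rv_sum.
rewrite ler_wpM2l ?exprn_ge0 ?invr_ge0 // !Rint_sum //; last first.
  by move=> e; exact: bounded_rvZ.
apply: ler_sum => e _; rewrite RintZ //.
exact: symmetrization_step.
Qed.

Lemma Rint_deviation0_le n (c : nat -> R) (K : R) : (forall j, `|c j| <= 1) ->
  (forall s : n.-tuple Z, \sum_(e : {ffun 'I_n -> bool})
    fmax i0 (fun i => 2 * \sum_(j < n) sgnb R (e j) * p i (tnth s j))
    <= 2 ^+ n * K) ->
  \int[iid_law P n]_s fmax i0 (fun i => \sum_(j < n) centered (c j) i (tnth s j))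
  <= K.
Proof.
move=> c1 hK.
rewrite (eq_Rintegral _ (g := deviation c (fun=> 0))); last first.
  by move=> s _; congr (fmax i0 _); apply/funext => i; rewrite add0r.
apply: le_trans (Rint_deviation_le _ _ c1) _; rewrite -[K](Rint_cst (iid_law P n)).
apply: le_Rint; last first.
- move=> s; rewrite /rademacher exprVn ler_pdivrMl ?exprn_gt0 //.
  apply: le_trans _ (hK s); apply: ler_sum => e _; apply: fmax_le => i.
  by rewrite add0r; exact: (fmax_ge i0 (fun i => 2 * \sum_(j < n) sgnb R (e j) * p i (tnth s j))).
- exact: bounded_rv_cst.
- apply: (bounded_rv_rademacher (a := fun _ _ => 0) (g := id)).
  - by move=> i; exact: bounded_rv_cst.
  - exact: measurable_id.
Qed.

End UniformDeviation.

(** * Excess prediction error *)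

(** The difference of the two squares is the empirical variance of the [|x j|]. *)
Lemma mean_le_root_mean_sqr (R : realType) m (x : 'I_m -> R) : (0 < m)%N ->
  m%:R^-1 * \sum_j `|x j| <= Num.sqrt (m%:R^-1 * \sum_j `|x j| ^+ 2).
Proof.
move=> m0; set a := m%:R^-1 * _; have mne : m%:R != 0 :> R by rewrite pnatr_eq0 -lt0n.
have m'0 : 0 <= m%:R^-1 :> R by rewrite invr_ge0.
have a0 : 0 <= a by rewrite mulr_ge0 // sumr_ge0.
rewrite -[a]ger0_norm // -sqrtr_sqr ler_wsqrtr // -subr_ge0.
have -> : m%:R^-1 * (\sum_j `|x j| ^+ 2) - a ^+ 2 =
    m%:R^-1 * \sum_j (`|x j| - a) ^+ 2.
  have -> : \sum_j (`|x j| - a) ^+ 2 =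
      \sum_j `|x j| ^+ 2 - 2 * a * (\sum_j `|x j|) + m%:R * a ^+ 2.
    transitivity (\sum_j (`|x j| ^+ 2 - 2 * a * `|x j| + a ^+ 2)).
      by apply: eq_bigr => j _; ring.
    by rewrite big_split sumrB -mulr_sumr /= sumr_const card_ord -[_ *+ m]mulr_natl.
  have -> : \sum_j `|x j| = m%:R * a by rewrite /a mulVKf.
  by field.
by rewrite mulr_ge0 // sumr_ge0 // => j _; exact: sqr_ge0.
Qed.

Section Excess.
Context (R : realType) (d : nat) (dZ : measure_display) (Z : measurableType dZ).
Context (dW : measure_display) (W : measurableType dW).
Variables (P : probability Z R) (E : Z -> 'M[R[i]]_d) (hyp : W -> 'M[R[i]]_d).
Variables (rho0 : 'M[R[i]]_d).
Hypotheses (Ee : forall z, effect (E z)) (mE : measurable_mx E).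
Hypotheses (hs : forall w, state (hyp w)) (rs : state rho0).

Let q z := prob_outcome (E z) rho0.
Let pw w z := prob_outcome (E z) (hyp w).

Lemma bounded_rv_prob_outcome rho : state rho ->
  bounded_rv (fun z => prob_outcome (E z) rho).
Proof.
move=> st; split; last first.
  exists 1 => z; have /andP[p0 p1] := prob_outcome_itv (Ee z) st.
  by rewrite ger0_norm.
have -> : (fun z => prob_outcome (E z) rho) = (fun z => \sum_i \sum_j
    (complex.Re (E z i j) * complex.Re (rho j i) -
     complex.Im (E z i j) * complex.Im (rho j i))).
  apply/funext => z; rewrite /prob_outcome /mxtrace Re_sum; apply: eq_bigr => i _.
  rewrite mxE Re_sum; apply: eq_bigr => j _.
  by case: (E z i j) (rho j i) => ? ? [].
apply: measurable_sum => i; apply: measurable_sum => j.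
by apply: measurable_funB; apply: measurable_funM => //; case: (mE i j).
Qed.

Lemma pred_error_ge0 w : 0 <= pred_error E hyp P rho0 w.
Proof. exact: Rintegral_ge0. Qed.

Lemma pred_error_le1 w : pred_error E hyp P rho0 w <= 1.
Proof.
rewrite -[leRHS](Rint_cst P); apply: le_Rint.
- by apply: bounded_rv_norm; apply: bounded_rvB; exact: bounded_rv_prob_outcome.
- exact: bounded_rv_cst.
move=> z; have /andP[? ?] := prob_outcome_itv (Ee z) rs.
have /andP[? ?] := prob_outcome_itv (Ee z) (hs w).
by rewrite ler_norml; apply/andP; split; lra.
Qed.

Section Learner.
Context (C0 eps : R) (m m_train : nat) (m_test : nat).
Variable A : learner E hyp C0 eps m m_train.

Let born s (b : outcomes m m_train) := prob_outcome (measurement E m_test s b)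
  (tens (fun _ : copies m m_test m_train => rho0)).

(** Only the majorant [G] has to be a bounded random variable, so the risk of the output may be
    bounded through maxima over a finite net. *)
Lemma excess_le (G : (m + m).-tuple Z -> R) : bounded_rv G ->
  (forall s, \sum_b born s b * pred_error E hyp P rho0 (output A s b) <= G s) ->
  excess P rho0 (data_state P rho0 m m_test m_train) A <=
  \int[iid_law P (m + m)]_s G s - inf [set pred_error E hyp P rho0 w | w in [set: W]].
Proof.
move=> bG leG; rewrite /excess lerD2r /=; apply: ge0_le_Rint => // s.
rewrite leG andbT; apply: sumr_ge0 => b _.
by rewrite mulr_ge0 ?pred_error_ge0 //; exact: born_ge0.
Qed.

(** Risks are nonnegative, so subtracting their infimum cannot raise the bound. This settles the
    degenerate cases. *)
Lemma excess_le_uniform (K : R) : (forall w, pred_error E hyp P rho0 w <= K) ->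
  excess P rho0 (data_state P rho0 m m_test m_train) A <= K.
Proof.
move=> leK; have bK : bounded_rv (fun _ : (m + m).-tuple Z => K).
  exact: bounded_rv_cst.
apply: le_trans (excess_le bK _) _ => [s|].
   rewrite -[leRHS]mul1r -(sum_born Ee rs m_test m_train s) mulr_suml.
  by apply: ler_sum => b _; rewrite ler_wpM2l //; exact: born_ge0.
(* For empty [W] the infimum takes its conventional value 0. *)
rewrite Rint_cst gerBl; have [->|/set0P ne] := eqVneq [set pred_error E hyp P rho0 w | w in [set: W]] set0.
  by rewrite inf0.
by apply: lb_le_inf => // _ [w _ <-]; exact: pred_error_ge0.
Qed.

End Learner.

(** * Uniform deviation over a finite net of hypothesis states *)

Section StateClass.
Variables (I : finType) (i0 : I) (rep : I -> W) (p n : nat).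
Hypotheses (n0 : (0 < n)%N) (p0 : (0 < p)%N) (dp : (d <= 2 ^ p)%N).
Variable (tgt : Z -> R) (bt : bounded_rv tgt).
Variables (c : nat -> R) (c1 : forall j, `|c j| <= 1).

Definition class_deviation (s : n.-tuple Z) : R :=
  fmax i0 (fun i => \sum_(j < n)
    centered P (fun i => pw (rep i)) tgt (c j) i (tnth s j)).

Let bp i : bounded_rv (pw (rep i)).
Proof. exact: bounded_rv_prob_outcome. Qed.

Lemma bounded_rv_class_deviation : bounded_rv class_deviation.
Proof.
apply: bounded_rv_fmax => i; apply: bounded_rv_sum => j.
apply: (bounded_rv_comp (g := fun s => tnth s j)); first exact: measurable_tnth.
exact: bounded_rv_centered.
Qed.

(** For each sign vector [signed_retr_le] bounds all representatives at once by a trace moment of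
    the signed sum. The 8 collects three factors 2: symmetrization, the two summands of 1 plus the
    moment, and the scale [K]. *)
Lemma Rint_class_deviation_le :
  \int[iid_law P n]_s class_deviation s <= 8 * Num.sqrt (p * n)%:R.
Proof.
apply: Rint_deviation0_le => // s.
pose A (j : 'I_n) := E (tnth s j); have Ae j : effect (A j) by exact: Ee.
set K := 2 * Num.sqrt (p * n)%:R : R.
have K0 : 0 < K by rewrite mulr_gt0 // sqrtr_gt0 ltr0n muln_gt0 p0.
have := sum_khintchine_le Ae n0 p0 dp; rewrite /= -/K => le1.
have -> : 2 ^+ n * (8 * Num.sqrt (p * n)%:R) = 2 * (2 ^+ n * (2 * K)) :> R.
  by rewrite /K; ring.
rewrite -(ler_pM2l (x := 2)) // in le1; apply: le_trans le1; rewrite mulr_sumr.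
apply: ler_sum => e _; apply: fmax_le => i; rewrite ler_pM2l //.
have := signed_retr_le (signed_sum_herm e Ae) (hs (rep i)) K0 p0.
rewrite /signed_sum mulmx_suml retr_sum; apply: le_trans.
rewrite le_eqVlt; apply/orP; left; apply/eqP; apply: eq_bigr => j _.
by rewrite -scalemxAl retrZ.
Qed.

(** Passing from [w] to its representative moves the mean loss and each sample loss by at most
    [delta], hence each of the [n] terms by at most [2 * delta]. *)
Lemma class_deviation_ge (delta : R) w i s :
  (forall A, effect A ->
    `|prob_outcome A (hyp w) - prob_outcome A (hyp (rep i))| <= delta) ->
  \sum_(j < n) c j * (\int[P]_z `|pw w z - tgt z| - `|pw w (tnth s j) - tgt (tnth s j)|)
  <= class_deviation s + n%:R * (2 * delta).
Proof.
move=> close; pose f v z : R := `|pw v z - tgt z|.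
have bf v : bounded_rv (f v).
  by apply: bounded_rv_norm; apply: bounded_rvB => //; exact: bounded_rv_prob_outcome.
have closef z : `|f w z - f (rep i) z| <= delta.
  apply: le_trans (ler_dist_dist _ _) _.
  by rewrite opprB addrA subrK; exact: close.
have closeI : `|\int[P]_z f w z - \int[P]_z f (rep i) z| <= delta.
  rewrite -[X in _ - X]mul1r -mulNr -RintZ // -RintD //; last exact: bounded_rvZ.
  apply: Rint_norm_le; first by apply: bounded_rvD => //; exact: bounded_rvZ.
  by move=> z; rewrite mulN1r.
apply: (@le_trans _ _ (\sum_(j < n) (centered P (fun i => pw (rep i)) tgt (c j) i (tnth s j)
    + 2 * delta))); last first.
  rewrite big_split /= sumr_const card_ord -[(2 * delta) *+ n]mulr_natl lerD2r.
  exact: (fmax_ge i0 (fun i => \sum_(j < n) centered P (fun i => pw (rep i)) tgt (c j) i (tnth s j))).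
apply: ler_sum => j _; rewrite -lerBlDl /centered -mulrBr.
apply: le_trans (ler_norm _) _; rewrite normrM.
apply: (@le_trans _ _ (`|\int[P]_z f w z - f w (tnth s j) -
   (\int[P]_z f (rep i) z - f (rep i) (tnth s j))|)); first by rewrite ler_piMl.
have swap (x y x' y' : R) : x - y - (x' - y') = (x - x') - (y - y') by ring.
rewrite swap; apply: le_trans (ler_normB _ _) _.
by rewrite mulr_natl mulr2n; exact: lerD.
Qed.

End StateClass.

End Excess.

(** * Risk of the empirical minimizer *)

Section UniformConvergence.
Context (R : realType) (d : nat) (dZ : measure_display) (Z : measurableType dZ).
Context (dW : measure_display) (W : measurableType dW).
Variables (P : probability Z R) (E : Z -> 'M[R[i]]_d) (hyp : W -> 'M[R[i]]_d).
Variables (rho0 : 'M[R[i]]_d).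
Hypotheses (Ee : forall z, effect (E z)) (mE : measurable_mx E).
Hypotheses (hs : forall w, state (hyp w)) (rs : state rho0).
Context (C0 eps : R) (m m_train m_test : nat).
Variable A : learner E hyp C0 eps m m_train.
Hypotheses (m0 : (0 < m)%N) (M0 : (0 < m_train)%N).

Let q z := prob_outcome (E z) rho0.
Let pw w z := prob_outcome (E z) (hyp w).
Let risk := pred_error E hyp P rho0.

(** Masks make the deviation of either half a function of all [2m] draws, so that [P^(2m)] never has
    to be split into a product. *)
Definition fst_mask (j : nat) : R := (j < m)%:R.
Definition snd_mask (sgn : R) (j : nat) : R := sgn * (m <= j)%:R.

Lemma sum_fst_mask (x : 'I_(m + m) -> R) :
  \sum_(j < m + m) fst_mask j * x j = \sum_(i < m) x (lshift m i).
Proof.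
rewrite big_split_ord /= [X in _ + X]big1 ?addr0; last first.
  by move=> i _; rewrite /fst_mask /= ltnNge leq_addr mul0r.
by apply: eq_bigr => i _; rewrite /fst_mask /= ltn_ord mul1r.
Qed.

Lemma sum_snd_mask sgn (x : 'I_(m + m) -> R) :
  \sum_(j < m + m) snd_mask sgn j * x j = sgn * \sum_(i < m) x (rshift m i).
Proof.
rewrite big_split_ord /= [X in X + _]big1 ?add0r; last first.
  by move=> i _; rewrite /snd_mask /= leqNgt ltn_ord mulr0 mul0r.
by rewrite mulr_sumr; apply: eq_bigr => i _; rewrite /snd_mask /= leq_addr mulr1.
Qed.

(** By the triangle inequality, replacing measured frequencies by true probabilities costs at most
    the total frequency error, uniformly in [w]. *)
Lemma emp_loss_le (s : (m + m).-tuple Z) (b : outcomes m m_train) w :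
  `|m%:R * emp_loss E hyp (second_half s) b w -
    \sum_(i < m) `|pw w (tnth s (rshift m i)) - q (tnth s (rshift m i))| |
  <= \sum_(i < m) `|emp_freq R b i - q (tnth (second_half s) i)|.
Proof.
rewrite /emp_loss mulVKf ?pnatr_eq0 -?lt0n // -sumrB.
apply: le_trans (ler_norm_sum _ _ _) (ler_sum _ _) => i _.
rewrite /second_half !tnth_mktuple; apply: le_trans (ler_dist_dist _ _) _.
by rewrite opprB addrC subrKA distrC.
Qed.

(** The empirical seminorm is a root mean square and dominates the mean absolute difference. *)
Lemma sum_emp_dist (s : (m + m).-tuple Z) w w1 :
  \sum_(i < m) `|pw w1 (tnth s (lshift m i)) - pw w (tnth s (lshift m i))|
  <= m%:R * emp_dist E hyp (first_half s) w w1.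
Proof.
rewrite -ler_pdivrMl ?ltr0n //; apply: le_trans (mean_le_root_mean_sqr _ m0) _.
rewrite ler_wsqrtr // ler_wpM2l ?invr_ge0 // le_eqVlt; apply/orP; left; apply/eqP.
by apply: eq_bigr => i _; rewrite tnth_mktuple mulmxBr retrD retrN distrC.
Qed.

(* The output is compared to the net point closest to the near-optimal [ws] in
   the empirical seminorm of the first half. *)
Lemma risk_output_le (I : finType) (i0 : I) (rep : I -> W) (delta : R) ws s b :
  (forall w, exists t, forall B, effect B ->
    `|prob_outcome B (hyp w) - prob_outcome B (hyp (rep t))| <= delta) ->
  m%:R * risk (output A s b) <=
  m%:R * (risk ws + eps + 12 * delta) +
  (class_deviation P E hyp i0 rep q (snd_mask 1) s +
   class_deviation P E hyp i0 rep q (snd_mask (-1)) s +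
   class_deviation P E hyp i0 rep (pw ws) fst_mask s) +
  2 * \sum_(i < m) `|emp_freq R b i - q (tnth (second_half s) i)|.
Proof.
move=> rep_close; set what := output A s b.
(* The arithmetic of the argument: generalization on the second half ([D1], [D2]) and the first
   ([D3]), the triangle inequality through the net point, the covering radius, minimality, and two
   passages to measured frequencies. *)
have chain (rhat r1 rs' lhat l1 D1 D2 D3 dist edist meps ehat e1 N dd : R) :
    rhat - lhat <= D1 + dd -> l1 - r1 <= D2 + dd -> dist - edist <= D3 + dd ->
    r1 <= rs' + dist -> edist <= meps -> ehat <= e1 -> - (ehat - lhat) <= N ->
    e1 - l1 <= N -> rhat <= rs' + meps + 3 * dd + (D1 + D2 + D3) + 2 * N.
  by move=> *; lra.
have [w1 w1net w1eps] := net_covering A (first_half s) ws.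
have m_neq0 : m%:R != 0 :> R by rewrite pnatr_eq0 -lt0n.
have riskE w : risk w = \int[P]_z `|pw w z - q z|.
  by apply: eq_Rintegral => z _; rewrite distrC.
have bq : bounded_rv q by exact: bounded_rv_prob_outcome.
have bpw w : bounded_rv (pw w) by exact: bounded_rv_prob_outcome.
pose L w := \sum_(i < m) `|pw w (tnth s (rshift m i)) - q (tnth s (rshift m i))|.
(* Each of the three deviations charges [2 * delta] to all [2m] terms, which gives [12 * delta]
   after division by [m]. *)
have mm : (m + m)%:R * (2 * delta) = m%:R * (4 * delta) :> R by rewrite natrD; ring.
have snd1 sgn : `|sgn| <= 1 -> forall j, `|snd_mask sgn j| <= 1.
  by move=> s1 j; rewrite /snd_mask normrM; case: (m <= j)%N;
    rewrite ?normr1 ?mulr1 // normr0 mulr0.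
have fst1 j : `|fst_mask j| <= 1.
  by rewrite /fst_mask; case: (j < m)%N; rewrite ?normr1 // normr0.
have h1 : m%:R * risk what - L what <=
    class_deviation P E hyp i0 rep q (snd_mask 1) s + m%:R * (4 * delta).
  have [t tc] := rep_close what.
  have := class_deviation_ge P Ee mE hs i0 bq (snd1 1 _) s tc.
  rewrite normr1 => /(_ (lexx _)); rewrite mm sum_snd_mask mul1r.
  by rewrite sumrB sumr_const card_ord -riskE -[_ *+ m]mulr_natl.
have h2 : L w1 - m%:R * risk w1 <=
    class_deviation P E hyp i0 rep q (snd_mask (-1)) s + m%:R * (4 * delta).
  have [t tc] := rep_close w1.
  have := class_deviation_ge P Ee mE hs i0 bq (snd1 (-1) _) s tc.
  rewrite normrN1 => /(_ (lexx _)); rewrite mm sum_snd_mask mulN1r.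
  by rewrite sumrB sumr_const card_ord -riskE -[_ *+ m]mulr_natl opprB.
have h3 : m%:R * \int[P]_z `|pw w1 z - pw ws z| -
    \sum_(i < m) `|pw w1 (tnth s (lshift m i)) - pw ws (tnth s (lshift m i))| <=
    class_deviation P E hyp i0 rep (pw ws) fst_mask s + m%:R * (4 * delta).
  have [t tc] := rep_close w1.
  have := class_deviation_ge P Ee mE hs i0 (bpw ws) fst1 s tc.
  rewrite mm sum_fst_mask.
  by rewrite sumrB sumr_const card_ord -[_ *+ m]mulr_natl.
have h4 : m%:R * risk w1 <= m%:R * risk ws + m%:R * \int[P]_z `|pw w1 z - pw ws z|.
  rewrite -mulrDr ler_wpM2l // !riskE -RintD; last 2 first.
  - by apply: bounded_rv_norm; exact: bounded_rvB.
  - by apply: bounded_rv_norm; exact: bounded_rvB.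
  apply: le_Rint.
  - by apply: bounded_rv_norm; exact: bounded_rvB.
  - by apply: bounded_rvD; apply: bounded_rv_norm; exact: bounded_rvB.
  by move=> z; rewrite [leRHS]addrC; exact: ler_distD.
have h5 : \sum_(i < m) `|pw w1 (tnth s (lshift m i)) - pw ws (tnth s (lshift m i))|
    <= m%:R * eps.
  by apply: le_trans (sum_emp_dist _ _ _) _; rewrite ler_wpM2l.
have h6 : m%:R * emp_loss E hyp (second_half s) b what <=
    m%:R * emp_loss E hyp (second_half s) b w1.
  by rewrite ler_wpM2l //; exact: output_argmin.
have /ler_normlP[h7 _] := emp_loss_le s b what.
have /ler_normlP[_ h8] := emp_loss_le s b w1.
apply: le_trans (chain _ _ _ _ _ _ _ _ _ _ _ _ _ _ _ h1 h2 h3 h4 h5 h6 h7 h8) _.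
rewrite !lerD2r le_eqVlt; apply/orP; left; apply/eqP.
by move: (risk ws) => r; ring.
Qed.

(** The bound of [risk_output_le] is averaged over outcomes and sample; three deviations with
    constant 8 produce 24. The slack [e] lets the mesh tend to 0. *)
Lemma excess_le_rate (w0 : W) p : (0 < p)%N -> (d <= 2 ^ p)%N ->
  excess P rho0 (data_state P rho0 m m_test m_train) A <=
  eps + 24 * Num.sqrt (p * (m + m))%:R / m%:R + 2 / Num.sqrt m_train%:R.
Proof.
(* 13 = 12 + 1: [12 * delta] for the net and one [delta] for the near-optimality of [ws]. *)
move=> p0 dp; apply/ler_addgt0Pr => e e0; pose delta := e / 13.
have delta0 : 0 < delta by rewrite divr_gt0.
have [I [i0 [rep rep_close]]] := finite_net w0 delta0 hs.
have mp : 0 < m%:R :> R by rewrite ltr0n.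
have n0 : (0 < m + m)%N by rewrite addn_gt0 m0.
set S := [set pred_error E hyp P rho0 w | w in [set: W]].
have Sinf : has_inf S.
  by split; [exists (risk w0), w0 | exists 0 => _ [w _ <-]; exact: pred_error_ge0].
(* [ws] is chosen before the sample is drawn, so [pw ws] is a fixed target for the first-half
   deviation [D3]. *)
have [_ [ws _ <-] wsS] := inf_adherent delta0 Sinf.
rewrite -/(risk ws) in wsS.
have bq : bounded_rv q by exact: bounded_rv_prob_outcome.
have bpw w : bounded_rv (pw w) by exact: bounded_rv_prob_outcome.
have snd1 sgn : `|sgn| <= 1 -> forall j, `|snd_mask sgn j| <= 1.
  by move=> s1 j; rewrite /snd_mask normrM; case: (m <= j)%N;
    rewrite ?normr1 ?mulr1 // normr0 mulr0.
have fst1 j : `|fst_mask j| <= 1.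
  by rewrite /fst_mask; case: (j < m)%N; rewrite ?normr1 // normr0.
have one1 : `|1 : R| <= 1 by rewrite normr1.
have mone1 : `|-1 : R| <= 1 by rewrite normrN1.
pose D1 := class_deviation P E hyp i0 rep q (snd_mask 1) : (m + m).-tuple Z -> R.
pose D2 := class_deviation P E hyp i0 rep q (snd_mask (-1)) : (m + m).-tuple Z -> R.
pose D3 := class_deviation P E hyp i0 rep (pw ws) fst_mask : (m + m).-tuple Z -> R.
have b1 : bounded_rv D1 by exact: bounded_rv_class_deviation.
have b2 : bounded_rv D2 by exact: bounded_rv_class_deviation.
have b3 : bounded_rv D3 by exact: bounded_rv_class_deviation.
pose K := risk ws + eps + 12 * delta + 2 / Num.sqrt m_train%:R.
pose G s := K + m%:R^-1 * (D1 s + D2 s + D3 s).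
have bD : bounded_rv (fun s => D1 s + D2 s + D3 s) by do 2 apply: bounded_rvD => //.
have bG : bounded_rv G.
  by apply: bounded_rvD; [exact: bounded_rv_cst | exact: bounded_rvZ].
apply: le_trans (excess_le Ee rs bG _) _ => [s|].
  pose pr b := prob_outcome (measurement E m_test s b)
    (tens (fun _ : copies m m_test m_train => rho0)).
  have pr1 : \sum_b pr b = 1 by exact: sum_born.
  have pr0 b : 0 <= pr b by exact: born_ge0.
  pose N (b : outcomes m m_train) := \sum_(i < m) `|emp_freq R b i - q (tnth (second_half s) i)|.
  apply: (@le_trans _ _ (\sum_b pr b *
      (risk ws + eps + 12 * delta + m%:R^-1 * (D1 s + D2 s + D3 s) +
       2 * (m%:R^-1 * N b)))).
    apply: ler_sum => b _; apply: ler_wpM2l; first exact: pr0.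
    have := risk_output_le i0 ws s b rep_close.
    rewrite -/(D1 s) -/(D2 s) -/(D3 s) -/(N b) => le.
    rewrite -(ler_pM2l mp); apply: le_trans le _.
    rewrite le_eqVlt; apply/orP; left; apply/eqP; field.
    by rewrite gt_eqF.
  under eq_bigr do rewrite mulrDr.
  rewrite big_split /= -mulr_suml pr1 mul1r /G /K.
  rewrite [leRHS]addrAC lerD2l.
  have -> : \sum_b pr b * (2 * (m%:R^-1 * N b)) = 2 * (m%:R^-1 * \sum_b pr b * N b).
    by rewrite !mulr_sumr; apply: eq_bigr => b _; ring.
  rewrite ler_pM2l // mulrC ler_pdivrMr // -div1r.
  (* The expected frequency error is bounded index by index; the [m] equal bounds cancel the factor
     [1/m]. *)
  under eq_bigr do rewrite mulr_sumr.
  rewrite exchange_big /= mulr_natr -[X in _ *+ X]card_ord -sumr_const.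
  by apply: ler_sum => i _; exact: (born_emp_freq Ee rs m_test s i M0).
rewrite /G RintD //; [|exact: bounded_rv_cst|exact: bounded_rvZ].
rewrite Rint_cst RintZ // RintD //; last exact: bounded_rvD.
rewrite RintD //.
have i1 : \int[iid_law P (m + m)]_s D1 s <= 8 * Num.sqrt (p * (m + m))%:R.
  by apply: Rint_class_deviation_le => //; exact: snd1.
have i2 : \int[iid_law P (m + m)]_s D2 s <= 8 * Num.sqrt (p * (m + m))%:R.
  by apply: Rint_class_deviation_le => //; exact: snd1.
have i3 : \int[iid_law P (m + m)]_s D3 s <= 8 * Num.sqrt (p * (m + m))%:R.
  exact: Rint_class_deviation_le.
have i123 : m%:R^-1 * (\int[iid_law P (m + m)]_s D1 s +
    \int[iid_law P (m + m)]_s D2 s + \int[iid_law P (m + m)]_s D3 s) <=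
    24 * Num.sqrt (p * (m + m))%:R / m%:R.
  rewrite [leRHS]mulrC ler_pM2l ?invr_gt0 //.
  by move: i1 i2 i3; move: (\int[_]_s D1 s) (\int[_]_s D2 s) (\int[_]_s D3 s) => ? ? ? ? ? ?; lra.
move: i123 wsS; rewrite /K -/S.
have -> : 12 * delta = e - delta by rewrite /delta; field.
move: (m%:R^-1 * _) (inf S) (risk ws) (24 * _ / _) (2 / _) => *; lra.
Qed.

End UniformConvergence.

(** * Natural logarithms and the final rate *)

Lemma up_log2_le_ln (R : realType) d : (1 < d)%N -> (up_log 2 d)%:R <= 4 * ln d%:R :> R.
Proof.
move=> d1; have p0 : (0 < up_log 2 d)%N by rewrite up_log_gt0.
have /andP[lt_d _] := up_log_bounds (isT : (1 < 2)%N) d1.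
(* From [ln (1 + x) <= x] at [x = -1/2]. *)
have ln2 : 1 / 2 <= ln 2 :> R.
  have := @le_ln1Dx R (- (1 / 2)); rewrite (_ : 1 + - (1 / 2) = 2^-1); last by field.
  by rewrite lnV ?posrE // => /(_ _); lra.
have ln_d : (up_log 2 d).-1%:R * ln 2 <= ln d%:R :> R.
  rewrite mulr_natl -lnXn // ler_ln ?posrE ?exprn_gt0 // ?ltr0n ?(ltnW d1) //.
  by rewrite -natrX ler_nat ltnW.
have ln2_d : ln 2 <= ln d%:R :> R.
  by rewrite ler_ln ?posrE ?ltr0n ?ler_nat // ltnW.
(* In [(p - 1) + 1] both summands are at most [2 ln d], because [ln 2 >= 1/2]. *)
have : (up_log 2 d)%:R = (up_log 2 d).-1%:R + 1 :> R by rewrite natr1 prednK.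
have : 0 <= (up_log 2 d).-1%:R :> R by [].
move: ((up_log 2 d).-1%:R) ((up_log 2 d)%:R) (ln d%:R) (ln 2) ln2 ln_d ln2_d => *.
by nra.
Qed.

Theorem corollary5p1 (R : realType) (C0 : R) (hC0 : 0 < C0) :
  exists (C : R) (k : nat), 0 < C /\
  forall (d m m_train m_test : nat) (eps : R)
    (rho0 : 'M[R[i]]_d)
    (dZ : measure_display) (Z : measurableType dZ)
    (P : probability Z R) (E : Z -> 'M[R[i]]_d)
    (dW : measure_display) (W : measurableType dW)
    (hyp : W -> 'M[R[i]]_d)
    (A : learner E hyp C0 eps m m_train),
  (0 < d)%N -> (0 < m)%N -> (0 < m_train)%N -> (0 < m_test)%N ->
  0 < eps ->
  state rho0 ->
  (forall z, effect (E z)) -> measurable_mx E ->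
  (forall w, state (hyp w)) -> measurable_mx hyp ->
  excess P rho0 (data_state P rho0 m m_test m_train) A
  <= eps + C * ((1 + ln (1 + eps^-1)) ^+ k
                  * Num.sqrt (ln d%:R / (m%:R * eps ^+ 2))
                + 1 / Num.sqrt m_train%:R + 1 / Num.sqrt m_test%:R).
Proof.
(* [72 = 24 * 3], with 24 from [excess_le_rate] and 3 from [rate_le]; no logarithmic factor in
   [1/eps] arises, hence the exponent 0. *)
exists 72, 0%N; split => // d m m_train m_test eps rho0 dZ Z P E dW W hyp A.
move=> d0 m0 M0 _ eps0 rs Ee mE hs _; rewrite expr0 mul1r !div1r.
set rate := Num.sqrt (ln d%:R / _).
have rest0 : 0 <= 72 * (rate + (Num.sqrt m_train%:R)^-1 + (Num.sqrt m_test%:R)^-1).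
  by rewrite mulr_ge0 // !addr_ge0 ?invr_ge0 ?sqrtr_ge0.
have triv (K : R) : (forall w, pred_error E hyp P rho0 w <= K) -> K <= eps ->
    excess P rho0 (data_state P rho0 m m_test m_train) A <=
    eps + 72 * (rate + (Num.sqrt m_train%:R)^-1 + (Num.sqrt m_test%:R)^-1).
  move=> leK Keps; apply: le_trans (excess_le_uniform Ee rs m_test A leK) _.
  by apply: le_trans Keps _; rewrite lerDl.
(* Risks never exceed 1. Afterwards [eps < 1], which at the end allows inserting [1/eps^2] under the
   root. *)
have [eps1|eps1] := leP 1 eps.
  by apply: triv eps1 => w; exact: pred_error_le1.
(* [w0] seeds the finite net; for empty [W] any uniform bound on risks holds vacuously. *)
have [[w0 _]|noW] := pselect (exists _ : W, True); last first.
  by apply: triv (ltW eps0) => w; case: noW; exists w.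
(* In dimension 1 there is a single state, so every risk is 0; [d > 1] makes the exponent
   [up_log 2 d] positive. *)
have [d1|d1] := leqP d 1.
  have {d0 d1} dE : d = 1%N by apply/eqP; rewrite eqn_leq d1.
  subst d; apply: triv (ltW eps0) => w; rewrite /pred_error.
  suff -> : hyp w = rho0 by under eq_Rintegral do rewrite subrr normr0; rewrite Rint_cst.
  apply/matrixP => i j; rewrite !ord1; have := (hs w).2; rewrite -rs.2.
  by rewrite !trace_mx11.
have p0 : (0 < up_log 2 d)%N by rewrite up_log_gt0.
have dp : (d <= 2 ^ up_log 2 d)%N by rewrite up_logP.
apply: le_trans (excess_le_rate P Ee mE hs rs m_test A m0 M0 w0 p0 dp) _.
rewrite -addrA lerD2l.
have mp : 0 < m%:R :> R by rewrite ltr0n.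
suff rate_le : Num.sqrt (up_log 2 d * (m + m))%:R / m%:R <= 3 * rate.
  have M'0 : 0 <= (Num.sqrt m_train%:R)^-1 :> R by rewrite invr_ge0 sqrtr_ge0.
  have T'0 : 0 <= (Num.sqrt m_test%:R)^-1 :> R by rewrite invr_ge0 sqrtr_ge0.
  move: rate_le M'0 T'0 {rest0 triv}; rewrite -[24 * _ / _]mulrA.
  by move: (_ / m%:R) (Num.sqrt m_train%:R)^-1 (Num.sqrt m_test%:R)^-1 rate => *; lra.
(* Comparison under the root with [p = up_log 2 d]: [p * 2m / m^2 <= 8 ln d / m] since
   [p <= 4 ln d], and [8 <= 9 / eps^2]. *)
rewrite -[m%:R in leLHS]ger0_norm // -sqrtr_sqr -sqrtrV -?sqrtrM //.
rewrite -[3]ger0_norm // -sqrtr_sqr -sqrtrM ?sqr_ge0 //.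
apply: ler_wsqrtr.
have lnd0 : 0 <= ln d%:R :> R by rewrite ln_ge0 // ler1n ltnW.
apply: (@le_trans _ _ (8 * (ln d%:R / m%:R))).
  rewrite natrM natrD expr2 ler_pdivrMr ?mulr_gt0 //.
  have -> : 8 * (ln d%:R / m%:R) * (m%:R * m%:R) = 4 * ln d%:R * (m%:R + m%:R) :> R.
    by field; rewrite gt_eqF.
  by rewrite ler_wpM2r ?addr_ge0 // up_log2_le_ln.
have -> : 3 ^+ 2 * (ln d%:R / (m%:R * eps ^+ 2)) = 9 * (ln d%:R / m%:R) / eps ^+ 2 :> R.
  by field; rewrite !gt_eqF.
rewrite ler_pdivlMr ?exprn_gt0 //.
have x0 : 0 <= ln d%:R / m%:R :> R by rewrite divr_ge0.
have e2 : eps ^+ 2 <= 1 by rewrite expr_le1 ?(ltW eps0) // ltW.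
have e20 : 0 <= eps ^+ 2 by rewrite sqr_ge0.
by move: (ln d%:R / m%:R) (eps ^+ 2) x0 e2 e20 => *; nra.
Qed.
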